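(* Let $N\ge 6$ be an integer and $\alpha\in\{N^2,N(N+1)\}$. Then $g(h_\alpha)=\alpha-h_\alpha-C$, where $C=1$ if $\alpha=N^2$ and $N=2^l+1$ for some integer $l\ge1$; $C=3$ if $\alpha=N^2$ and $N\equiv 1 \pmod 3$, or if $\alpha=N(N+1)$ and $N\not\equiv 2\pmod 3$; $C=4$ if $\alpha=N^2$, $N\not\equiv 1\pmod 3$ and $N\neq 2^l+1$ for every integer $l\ge 1$; $C=5$ if $\alpha=N(N+1)$ and $N\equiv 2\pmod 3$.
   Context: A polyomino is a finite union of closed unit squares (tiles) of the square lattice, any two meeting (if at all) in a whole edge, whose interior is connected. Its holes are the bounded connected components of its complement in the plane; $h(A)$ is the number of holes of $A$ and $|A|$ its number of tiles. For $h\ge 1$, $g(h)=\min\{|A| : A \text{ a polyomino with } h(A)=h\}$. For a positive integer $N$ and $\alpha\in\{N^2, N(N+1)\}$, $h_\alpha$ denotes the maximum number of holes of a polyomino contained in the $N\times N$ square (if $\alpha=N^2$), respectively in the $N\times(N+1)$ rectangle (if $\alpha=N(N+1)$). *)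

(* Defs.v *)
From Stdlib Require Import ZArith List Arith Lia.
Import ListNotations.
Open Scope Z_scope.

(* The tile (cell) (x,y) is the closed unit square [x,x+1] x [y,y+1]. *)
Definition cell := (Z * Z)%type.

Definition adj (p q : cell) : Prop :=
  Z.abs (fst p - fst q) + Z.abs (snd p - snd q) = 1.

Inductive path_in (S : cell -> Prop) : cell -> cell -> Prop :=
| path_refl p : S p -> path_in S p p
| path_step p q r : S p -> adj p q -> path_in S q r -> path_in S p r.

(* A polyomino, given by the (duplicate-free, nonempty) list of its tiles.
   The interior of the union of the tiles is connected iff the tiles are
   connected through shared edges. *)
Definition is_polyomino (A : list cell) : Prop :=
  NoDup A /\ A <> [] /\
  forall p q, In p A -> In q A -> path_in (fun x => In x A) p q.

Definition outside (A : list cell) : cell -> Prop := fun x => ~ In x A.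

Definition hole_cell (A : list cell) (p : cell) : Prop :=
  outside A p /\
  exists L : list cell, forall q, path_in (outside A) p q -> In q L.

Definition num_holes (A : list cell) (h : nat) : Prop :=
  exists reps : list cell,
    length reps = h /\ NoDup reps /\
    (forall r, In r reps -> hole_cell A r) /\
    (forall r1 r2, In r1 reps -> In r2 reps -> path_in (outside A) r1 r2 -> r1 = r2) /\
    (forall p, hole_cell A p -> exists r, In r reps /\ path_in (outside A) r p).

Definition in_box (N M : nat) (A : list cell) : Prop :=
  forall p, In p A ->
    0 <= fst p < Z.of_nat N /\ 0 <= snd p < Z.of_nat M.

(* H = h_alpha for alpha = N*M: maximal number of holes of a polyomino
   contained in the N x M rectangle. *)
Definition is_max_holes (N M : nat) (H : nat) : Prop :=
  (exists A, is_polyomino A /\ in_box N M A /\ num_holes A H) /\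
  (forall A h, is_polyomino A -> in_box N M A -> num_holes A h -> (h <= H)%nat).

Definition g_value (h : nat) (m : Z) : Prop :=
  (exists A, is_polyomino A /\ num_holes A h /\ Z.of_nat (length A) = m) /\
  (forall A, is_polyomino A -> num_holes A h -> m <= Z.of_nat (length A)).

(* The constant C of the theorem; M = N encodes alpha = N^2 and
   M = N+1 encodes alpha = N(N+1). *)
Definition pow2_plus1 (N : nat) : Prop :=
  exists l : nat, (1 <= l)%nat /\ N = (2 ^ l + 1)%nat.

Inductive C_spec (N M : nat) : Z -> Prop :=
| C_sq_pow2 : M = N -> pow2_plus1 N -> C_spec N M 1
| C_sq_mod1 : M = N -> (N mod 3 = 1)%nat -> C_spec N M 3
| C_rect_not2 : M = S N -> (N mod 3 <> 2)%nat -> C_spec N M 3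
| C_sq_other : M = N -> (N mod 3 <> 1)%nat -> ~ pow2_plus1 N -> C_spec N M 4
| C_rect_2 : M = S N -> (N mod 3 = 2)%nat -> C_spec N M 5.

(* Main.v *)
(* Put p = N - 1 and q = M - 1. Removing from the box one cell per hole, and
   filling all other cells, leaves a connected tile graph whose cyclomatic
   number is p*q - 3h. By duality, independent vertex labellings that are
   constant around every hole and vanish outside the box give independent
   cycles. The constant labelling gives p*q - 3h >= 1.

   Value 2: then one of p, q is odd, and since holes alternate along the sides
   of the box, two opposite sides each contain a grid vertex touching no hole,
   whose indicator is another labelling; so the value is at least 3.
   Value 1: the constant labelling is the only one, so every vertex touches a
   hole and all holes have the same colour (parity of x + y). Then p and q are
   even, all odd-odd cells are holes, and the even-even cells form a box of the
   same kind with p/2, q/2; hence p = q = 2^l.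

   Extremal examples: boxes with a cut D near the origin and corners shielded
   by inner tiles are extended by zigzag strips of width 3, which leave
   p*q - 3h unchanged, starting from six small boxes; even squares are obtained
   by doubling (all odd-odd cells become holes). Deleting D and two or three
   corners breaks all cycles.

   Minimality: a polyomino with n tiles, h holes and an a x b bounding box has
   n >= 2h + a + b - 1 (count the edges) and n + h <= a*b. *)

Require Import Defs.
From Stdlib Require Import ZArith List Arith Lia.
From Stdlib Require Import Classical.
Import ListNotations.
Open Scope bool_scope.
Open Scope Z_scope.

(** The residue of p*q modulo 3 nearly fixes C: residue 0 gives 3, residue 1 gives 1 or 4, residue 2
    gives 5 once the value 2 is excluded. Squares are never 2 modulo 3, so that exclusion concerns
    only q = p + 1, where one side is odd. In the extremal examples C deletions each break one cycle
    and leave a tree, so the edge count behind minimality becomes an equality. A vertex labelling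
    acts as a stream function: its differences along the sides shared by tiles form a circulation of
    the tile graph. Independence is certified by pivot edges in triangular form instead of a rank,
    and removing all pivots must leave the graph connected. The shape of the constructions comes
    from parity. A strip can be followed by a mirrored one only along a side with odd parameter, so
    boxes with p and q odd grow by 6 in both directions, and one last strip of width 3 produces an
    even side. Two even sides are out of reach this way, hence the doubling, which in turn demands
    that the deleted cells be pairwise non-adjacent. *)

Definition cell_eq (a b : cell) : {a = b} + {a <> b}.
Proof. decide equality; apply Z.eq_dec. Defined.

Definition mem (c : cell) (l : list cell) : bool :=
  existsb (fun d => (fst c =? fst d) && (snd c =? snd d)) l.

Lemma memP c l : mem c l = true <-> In c l.
Proof.
  unfold mem; rewrite existsb_exists; split.
  - intros (d & Hd & E). rewrite Bool.andb_true_iff, !Z.eqb_eq in E.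
    replace c with d; auto. destruct c, d; cbn in E; f_equal; easy.
  - intros Hc; exists c; split; auto. now rewrite !Z.eqb_refl.
Qed.

Lemma memPn c l : mem c l = false <-> ~ In c l.
Proof. now rewrite <- memP, Bool.not_true_iff_false. Qed.

(** * Paths and connected sets of cells *)

Lemma adj_sym a b : adj a b -> adj b a.
Proof. unfold adj; lia. Qed.

Lemma path_start S a b : path_in S a b -> S a.
Proof. now destruct 1. Qed.

Lemma path_end S a b : path_in S a b -> S b.
Proof. now induction 1. Qed.

Lemma path_trans S a b c : path_in S a b -> path_in S b c -> path_in S a c.
Proof. induction 1; auto; intros; econstructor; eauto. Qed.

Lemma path_one (S : cell -> Prop) a b : S a -> S b -> adj a b -> path_in S a b.
Proof. intros; econstructor; eauto; now constructor. Qed.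

Lemma path_sym S a b : path_in S a b -> path_in S b a.
Proof.
  induction 1 as [|p q r Hp Hpq Hqr IH]; [now constructor|].
  apply path_trans with q; auto.
  apply path_one; auto using adj_sym. now apply path_start in Hqr.
Qed.

Lemma path_mono (S S' : cell -> Prop) a b :
  (forall c, S c -> S' c) -> path_in S a b -> path_in S' a b.
Proof. intros HS; induction 1; [constructor | econstructor]; eauto. Qed.

Lemma path_inv (S P : cell -> Prop) a b :
  (forall c d, P c -> S c -> S d -> adj c d -> P d) -> path_in S a b -> P a -> P b.
Proof.
  intros HP; induction 1 as [|p q r Hp Hpq Hqr IH]; auto.
  intros Ha; apply IH; eapply HP; eauto. now apply path_start in Hqr.
Qed.

Definition connected (S : cell -> Prop) : Prop := forall a b, S a -> S b -> path_in S a b.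

(** A discrete retraction. To delete a cell from a connected set, [f] sends it to a surviving cell,
    and only the edges at the deleted cell have to be rerouted. *)
Lemma connected_retract (S F : cell -> Prop) (f : cell -> cell) :
  connected S ->
  (forall a, S a -> F (f a)) ->
  (forall a b, S a -> S b -> adj a b -> path_in F (f a) (f b)) ->
  forall a b, S a -> S b -> path_in F (f a) (f b).
Proof.
  intros HS Hf Hstep a b Ha Hb.
  specialize (HS a b Ha Hb); clear Hb.
  induction HS as [|p q r Hp Hpq Hqr IH]; [constructor; auto|].
  pose proof (path_start _ _ _ Hqr).
  eapply path_trans; eauto.
Qed.

Lemma hpath (S : cell -> Prop) y x1 x2 :
  x1 <= x2 -> (forall x, x1 <= x <= x2 -> S (x, y)) -> path_in S (x1, y) (x2, y).
Proof.
  intros Hx.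
  replace x2 with (x1 + Z.of_nat (Z.to_nat (x2 - x1))) by lia.
  generalize (Z.to_nat (x2 - x1)); clear Hx x2; intros n.
  induction n as [|n IH]; intros HS.
  - replace (x1 + Z.of_nat 0) with x1 in * by lia. constructor; apply HS; lia.
  - apply path_trans with (x1 + Z.of_nat n, y).
    + apply IH; intros; apply HS; lia.
    + apply path_one; [apply HS; lia | apply HS; lia | unfold adj; cbn; lia].
Qed.

Lemma vpath (S : cell -> Prop) x y1 y2 :
  y1 <= y2 -> (forall y, y1 <= y <= y2 -> S (x, y)) -> path_in S (x, y1) (x, y2).
Proof.
  intros Hx.
  replace y2 with (y1 + Z.of_nat (Z.to_nat (y2 - y1))) by lia.
  generalize (Z.to_nat (y2 - y1)); clear Hx y2; intros n.
  induction n as [|n IH]; intros HS.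
  - replace (y1 + Z.of_nat 0) with y1 in * by lia. constructor; apply HS; lia.
  - apply path_trans with (x, y1 + Z.of_nat n).
    + apply IH; intros; apply HS; lia.
    + apply path_one; [apply HS; lia | apply HS; lia | unfold adj; cbn; lia].
Qed.

Lemma hline (S : cell -> Prop) y x1 x2 :
  (forall x, x1 <= x <= x2 \/ x2 <= x <= x1 -> S (x, y)) -> path_in S (x1, y) (x2, y).
Proof.
  intros HS. destruct (Z_le_gt_dec x1 x2); [|apply path_sym]; apply hpath; try lia; auto.
Qed.

Lemma vline (S : cell -> Prop) x y1 y2 :
  (forall y, y1 <= y <= y2 \/ y2 <= y <= y1 -> S (x, y)) -> path_in S (x, y1) (x, y2).
Proof.
  intros HS. destruct (Z_le_gt_dec y1 y2); [|apply path_sym]; apply vpath; try lia; auto.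
Qed.

(** * Counting in finite lists *)

Lemma filter_split {A} (f : A -> bool) l :
  (length (filter f l) + length (filter (fun x => negb (f x)) l) = length l)%nat.
Proof. induction l as [|a l IH]; cbn; auto. destruct (f a); cbn; lia. Qed.

Lemma NoDup_map_inj {A B} (f : A -> B) l :
  (forall a b, In a l -> In b l -> f a = f b -> a = b) -> NoDup l -> NoDup (map f l).
Proof.
  intros Hf; induction 1 as [|a l Ha Hl IH]; cbn; constructor.
  - rewrite in_map_iff; intros (b & Hb & Hin).
    apply Hf in Hb; [subst; auto | right; auto | left; auto].
  - apply IH; intros; apply Hf; auto; now right.
Qed.

(** An injection in relational form: a hole or a line is only known to own some tile, and no choice
    function is required. *)
Lemma length_le_rel {A B} (P : A -> B -> Prop) (l : list A) (R : list B) :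
  NoDup l ->
  (forall a, In a l -> exists b, In b R /\ P a b) ->
  (forall a a' b, In a l -> In a' l -> P a b -> P a' b -> a = a') ->
  (length l <= length R)%nat.
Proof.
  intros Hnd Hex Hinj.
  assert (exists L, NoDup L /\ length L = length l /\ incl L R /\
            forall b, In b L -> exists a, In a l /\ P a b) as (L & H1 & H2 & H3 & _).
  { induction Hnd as [|a l Ha Hl IH].
    - exists []; repeat split; cbn; auto; [constructor | intros ? [] | intros ? []].
    - destruct IH as (L & H1 & H2 & H3 & H4).
      + intros; apply Hex; now right.
      + intros; eapply Hinj; eauto; now right.
      + destruct (Hex a) as (b & Hb & Pb); [now left|].
        exists (b :: L); repeat split; cbn; auto.
        * constructor; auto. intros HbL. destruct (H4 b HbL) as (a' & Ha' & Pa').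
          assert (a = a') by (eapply Hinj; eauto; [now left | now right]). subst; auto.
        * intros c [<-|Hc]; auto.
        * intros c [<-|Hc]; [exists a; auto|].
          destruct (H4 c Hc) as (a' & ? & ?); exists a'; auto. }
  rewrite <- H2. now apply NoDup_incl_length.
Qed.

(** * Lists of integers and boxes *)

Definition zrange (x0 : Z) (n : nat) : list Z := map (fun i => x0 + Z.of_nat i) (seq 0 n).

Lemma in_zrange x0 n x : In x (zrange x0 n) <-> x0 <= x < x0 + Z.of_nat n.
Proof.
  unfold zrange; rewrite in_map_iff; split.
  - intros (i & <- & Hi); apply in_seq in Hi; lia.
  - intros H; exists (Z.to_nat (x - x0)); split; [lia | apply in_seq; lia].
Qed.

Lemma NoDup_zrange x0 n : NoDup (zrange x0 n).
Proof. apply NoDup_map_inj; [intros; lia | apply seq_NoDup]. Qed.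

Lemma length_zrange x0 n : length (zrange x0 n) = n.
Proof. unfold zrange; now rewrite length_map, length_seq. Qed.

Lemma NoDup_prod {A B} (l : list A) (l' : list B) :
  NoDup l -> NoDup l' -> NoDup (list_prod l l').
Proof.
  intros Hl Hl'; induction Hl as [|a l Ha Hl IH]; cbn; [constructor|].
  apply NoDup_app; auto.
  - apply NoDup_map_inj; auto. intros ? ? ? ? E; now inversion E.
  - intros [u v] Hu Hv. apply in_map_iff in Hu as (w & E & _). inversion E; subst.
    apply in_prod_iff in Hv as []; auto.
Qed.

Definition zbox (x0 y0 : Z) (a b : nat) : list cell := list_prod (zrange x0 a) (zrange y0 b).

Lemma in_zbox x0 y0 a b c :
  In c (zbox x0 y0 a b) <->
  x0 <= fst c < x0 + Z.of_nat a /\ y0 <= snd c < y0 + Z.of_nat b.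
Proof.
  destruct c as [x y]. pose proof (in_prod_iff (zrange x0 a) (zrange y0 b) x y) as H.
  rewrite !in_zrange in H. exact H.
Qed.

Lemma NoDup_zbox x0 y0 a b : NoDup (zbox x0 y0 a b).
Proof. apply NoDup_prod; apply NoDup_zrange. Qed.

Lemma length_zbox x0 y0 a b : length (zbox x0 y0 a b) = (a * b)%nat.
Proof.
  pose proof (length_prod (zrange x0 a) (zrange y0 b)) as H.
  rewrite !length_zrange in H. exact H.
Qed.

Definition shift (d c : cell) : cell := (fst c + fst d, snd c + snd d).
Definition dirx : cell := (1, 0).
Definition diry : cell := (0, 1).

Definition links (d : cell) (A : list cell) : list cell := filter (fun c => mem (shift d c) A) A.

Lemma in_links d A c : In c (links d A) <-> In c A /\ In (shift d c) A.
Proof. unfold links; now rewrite filter_In, memP. Qed.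

Lemma adj_shift a b :
  adj a b -> b = shift dirx a \/ a = shift dirx b \/ b = shift diry a \/ a = shift diry b.
Proof.
  destruct a as [x y], b as [x' y']; unfold adj, shift; cbn; intros H.
  assert ((x' = x + 1 /\ y' = y) \/ (x = x' + 1 /\ y' = y) \/
          (y' = y + 1 /\ x' = x) \/ (y = y' + 1 /\ x' = x)) as [[]|[[]|[[]|[]]]] by lia;
    [left | right; left | do 2 right; left | do 3 right]; f_equal; lia.
Qed.

(** * Edges of a connected graph *)

(** Union-find: [f] names the class of each vertex, and each new edge merges at most two classes, so
    their number drops by at most one per edge. *)
Lemma merge_labels (V : list cell) (E : list (cell * cell)) :
  NoDup V ->
  exists f : cell -> cell, (forall a b, In (a, b) E -> f a = f b) /\
    (length V <= length (nodup cell_eq (map f V)) + length E)%nat.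
Proof.
  intros HV; induction E as [|[a b] E [f [Hf HE]]].
  - exists (fun c => c); split; [intros ? ? []|].
    rewrite map_id, nodup_fixed_point; auto. cbn; lia.
  - exists (fun v => if cell_eq (f v) (f b) then f a else f v); split.
    + intros c d [E1|Hin].
      * inversion E1; subst.
        destruct (cell_eq (f d) (f d)), (cell_eq (f c) (f d)); congruence.
      * now rewrite (Hf c d Hin).
    + set (f' := fun v => _).
      assert (length (nodup cell_eq (map f V)) <= length (f b :: nodup cell_eq (map f' V)))%nat.
      { apply NoDup_incl_length; [apply NoDup_nodup|].
        intros c Hc; rewrite nodup_In in Hc; apply in_map_iff in Hc as (v & <- & Hv).
        destruct (cell_eq (f v) (f b)) as [->|Hn]; [now left|right].
        apply nodup_In, in_map_iff; exists v; split; auto.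
        unfold f'; destruct (cell_eq (f v) (f b)); congruence. }
      cbn in *; lia.
Qed.

(** * Discrete circulations *)

Fixpoint zsum (f : Z -> Z) (n : nat) : Z :=
  match n with O => 0 | S n => zsum f n + f (Z.of_nat n) end.

Lemma zsum_ext f g n :
  (forall i, 0 <= i < Z.of_nat n -> f i = g i) -> zsum f n = zsum g n.
Proof.
  induction n; cbn; auto; intros H. rewrite IHn, (H (Z.of_nat n)); auto; try lia.
  intros; apply H; lia.
Qed.

Lemma zsum_0 f n : (forall i, 0 <= i < Z.of_nat n -> f i = 0) -> zsum f n = 0.
Proof.
  induction n; cbn; auto; intros H. rewrite IHn, (H (Z.of_nat n)); auto; try lia.
  intros; apply H; lia.
Qed.

Lemma zsum_single f n i0 :
  0 <= i0 < Z.of_nat n -> (forall i, 0 <= i < Z.of_nat n -> i <> i0 -> f i = 0) ->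
  zsum f n = f i0.
Proof.
  induction n; cbn -[Z.of_nat]; intros Hi H; [lia|].
  destruct (Z.eq_dec i0 (Z.of_nat n)) as [->|].
  - rewrite zsum_0; [lia|]; intros; apply H; lia.
  - rewrite IHn, (H (Z.of_nat n)); try lia; intros; apply H; lia.
Qed.

Lemma zsum_exchange (f : Z -> Z -> Z) n m :
  zsum (fun i => zsum (fun j => f i j) m) n = zsum (fun j => zsum (fun i => f i j) n) m.
Proof.
  assert (Hadd : forall f g k, zsum (fun i => f i + g i) k = zsum f k + zsum g k)
    by (intros f' g' k; induction k; cbn; lia).
  induction n; cbn.
  - now rewrite zsum_0.
  - now rewrite IHn, Hadd.
Qed.

Lemma zsum_abel u d n :
  u 0 = 0 -> u (Z.of_nat n) = 0 ->
  zsum (fun y => (u (y + 1) - u y) * d y) n =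
  - zsum (fun y => u (y + 1) * (d (y + 1) - d y)) n.
Proof.
  intros H0 Hn.
  assert (forall k, zsum (fun y => (u (y + 1) - u y) * d y) k =
    u (Z.of_nat k) * d (Z.of_nat k) - zsum (fun y => u (y + 1) * (d (y + 1) - d y)) k) as H.
  { induction k; cbn -[Z.of_nat]; [cbn; lia|].
    rewrite IHk. replace (Z.of_nat (S k)) with (Z.of_nat k + 1) by lia. lia. }
  rewrite H, Hn; lia.
Qed.

(** Labellings live on grid vertices, [(x, y)] being the lower left corner of the cell [(x, y)].
    When the cells have coordinates in 0..p and 0..q, the vertices interior to the box are 1..p by
    1..q. *)
Definition supported (p q : Z) (phi : Z -> Z -> Z) : Prop :=
  forall x y, phi x y <> 0 -> 1 <= x <= p /\ 1 <= y <= q.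

(** The flow from [c] to its right neighbour: the difference of the stream function [phi] between
    the two ends of their common side. *)
Definition jump (phi : Z -> Z -> Z) (c : cell) : Z :=
  phi (fst c + 1) (snd c + 1) - phi (fst c + 1) (snd c).

(** The flow has no divergence. Summation by parts, in y on the left and in x on the right, turns
    both sides into minus the sum of [phi] times the mixed second difference of [g]. *)
Lemma circulation p q phi (g : cell -> Z) :
  0 <= p -> 0 <= q -> supported p q phi ->
  zsum (fun x => zsum (fun y => jump phi (x, y) * (g (x + 1, y) - g (x, y)))
    (Z.to_nat (q + 1))) (Z.to_nat (p + 1)) =
  zsum (fun x => zsum (fun y =>
    (phi (x + 1) (y + 1) - phi x (y + 1)) * (g (x, y + 1) - g (x, y)))
    (Z.to_nat (q + 1))) (Z.to_nat (p + 1)).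
Proof.
  intros Hp Hq Hs.
  assert (Hz : forall x y, ~ (1 <= x <= p /\ 1 <= y <= q) -> phi x y = 0).
  { intros x y H; destruct (Z.eq_dec (phi x y) 0); auto; exfalso; auto. }
  transitivity (zsum (fun x => zsum (fun y => - (phi (x + 1) (y + 1) *
      (g (x + 1, y + 1) - g (x, y + 1) - (g (x + 1, y) - g (x, y)))))
    (Z.to_nat (q + 1))) (Z.to_nat (p + 1))).
  - apply zsum_ext; intros x _. unfold jump; cbn [fst snd].
    rewrite (zsum_abel (fun y => phi (x + 1) y) (fun y => g (x + 1, y) - g (x, y)));
      [|apply Hz; lia ..].
    induction (Z.to_nat (q + 1)); cbn; lia.
  - rewrite zsum_exchange.
    rewrite (zsum_exchange (fun x y => (phi (x + 1) (y + 1) - phi x (y + 1)) * _)).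
    apply zsum_ext; intros y _.
    rewrite (zsum_abel (fun x => phi x (y + 1)) (fun x => g (x, y + 1) - g (x, y)));
      [|apply Hz; lia ..].
    induction (Z.to_nat (p + 1)); cbn; lia.
Qed.

(** The four corners of a missing cell carry the same value, so no flow crosses its sides. *)
Definition flat (A : list cell) (phi : Z -> Z -> Z) : Prop :=
  forall x y, ~ In (x, y) A ->
    phi (x + 1) y = phi x y /\ phi x (y + 1) = phi x y /\ phi (x + 1) (y + 1) = phi x y.

(* [phi] jumps only across edges joining two tiles; Stokes' theorem on the
   square grid then kills the single edge across which [g] might differ. *)
Lemma circulation_single p q A phi (g : cell -> Z) e :
  0 <= p -> 0 <= q -> supported p q phi -> flat A phi ->
  (forall c, In c A -> In (shift diry c) A -> g (shift diry c) = g c) ->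
  (forall c, In c A -> In (shift dirx c) A -> c <> e -> jump phi c * (g (shift dirx c) - g c) = 0) ->
  jump phi e <> 0 -> g (shift dirx e) = g e.
Proof.
  intros Hp Hq Hs Hf Hv Hh He.
  assert (Hz : forall x y, ~ (1 <= x <= p /\ 1 <= y <= q) -> phi x y = 0).
  { intros x y H; destruct (Z.eq_dec (phi x y) 0); auto; exfalso; auto. }
  assert (Hsh : forall x y, shift dirx (x, y) = (x + 1, y) /\ shift diry (x, y) = (x, y + 1))
    by (intros; unfold shift; cbn; split; f_equal; lia).
  pose proof (circulation p q phi g Hp Hq Hs) as H.
  (* Vertical edges contribute nothing: two tiles carry the same [g], and next to a missing cell the
     flow is zero. *)
  rewrite (zsum_0 (fun x => zsum (fun y => (_ - phi x (y + 1)) * _) _)) in H.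
  2:{ intros x _; apply zsum_0; intros y _.
      destruct (Hsh x y) as [_ E2].
      destruct (in_dec cell_eq (x, y) A) as [H1|H1].
      - destruct (in_dec cell_eq (x, y + 1) A) as [H2|H2].
        + pose proof (Hv (x, y) H1) as H3; rewrite E2 in H3. rewrite H3; auto. lia.
        + destruct (Hf x (y + 1) H2) as (E & _). rewrite E; lia.
      - destruct (Hf x y H1) as (_ & E & E'). rewrite E, E'; lia. }
  destruct e as [x0 y0].
  (* A nonzero jump has an end inside the box, so [e] lies in the range of summation. *)
  assert (Hr : 0 <= x0 < Z.of_nat (Z.to_nat (p + 1)) /\ 0 <= y0 < Z.of_nat (Z.to_nat (q + 1))).
  { unfold jump in He; cbn [fst snd] in He.
    destruct (Z.eq_dec (phi (x0 + 1) (y0 + 1)) 0) as [E|E].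
    - destruct (Z.eq_dec (phi (x0 + 1) y0) 0) as [E'|E']; [lia|]. apply Hs in E'; lia.
    - apply Hs in E; lia. }
  assert (Ht : forall x y, (x, y) <> (x0, y0) -> jump phi (x, y) * (g (x + 1, y) - g (x, y)) = 0).
  { intros x y Hne. destruct (Hsh x y) as [E1 _].
    destruct (in_dec cell_eq (x, y) A) as [H1|H1].
    - destruct (in_dec cell_eq (x + 1, y) A) as [H2|H2].
      + rewrite <- E1. apply Hh; auto. now rewrite E1.
      + destruct (Hf (x + 1) y H2) as (_ & E & _). unfold jump; cbn [fst snd]. rewrite E; lia.
    - destruct (Hf x y H1) as (E & _ & E'). unfold jump; cbn [fst snd]. rewrite E, E'; lia. }
  rewrite (zsum_single _ _ x0) in H; [|lia|].
  2:{ intros x _ Hx; apply zsum_0; intros y _; apply Ht; congruence. }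
  rewrite (zsum_single _ _ y0) in H; [|lia|].
  2:{ intros y _ Hy; apply Ht; congruence. }
  destruct (Hsh x0 y0) as [-> _].
  apply Z.mul_eq_0 in H as [|]; [contradiction | lia].
Qed.

(** A certificate of linear independence: each labelling flows through its own pivot edge and
    through none of the later pivots. *)
Fixpoint triangular (L : list ((Z -> Z -> Z) * cell)) : Prop :=
  match L with
  | [] => True
  | (phi, e) :: L => jump phi e <> 0 /\ (forall e', In e' (map snd L) -> jump phi e' = 0) /\
                     triangular L
  end.

Lemma triangular_NoDup L : triangular L -> NoDup (map snd L).
Proof.
  induction L as [|[phi e] L IH]; cbn; [constructor|].
  intros (H1 & H2 & H3); constructor; auto.
Qed.

Lemma triangular_jump L e :
  triangular L -> In e (map snd L) -> exists phi, In phi (map fst L) /\ jump phi e <> 0.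
Proof.
  induction L as [|[phi e'] L IH]; cbn; [tauto|].
  intros (H1 & H2 & H3) [<-|H]; [exists phi; auto|].
  destruct (IH H3 H) as (psi & ? & ?); exists psi; auto.
Qed.

(** Elimination from the head: the first labelling has no flow through the later pivots, so its own
    pivot is the only term left in its circulation and [g] cannot differ there. Then the tail is
    treated. *)
Lemma triangular_kill p q A (g : cell -> Z) L :
  0 <= p -> 0 <= q ->
  (forall phi, In phi (map fst L) -> supported p q phi /\ flat A phi) ->
  (forall c, In c A -> In (shift diry c) A -> g (shift diry c) = g c) ->
  (forall c, In c A -> In (shift dirx c) A -> ~ In c (map snd L) -> g (shift dirx c) = g c) ->
  triangular L ->
  forall c, In c A -> In (shift dirx c) A -> g (shift dirx c) = g c.
Proof.
  intros Hp Hq HL Hv Hh Ht.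
  induction L as [|[phi e] L IH]; [intros; apply Hh; auto|].
  destruct Ht as (H1 & H2 & H3).
  apply IH; auto; [intros; apply HL; now right|].
  intros c Hc Hc' Hn.
  destruct (cell_eq c e) as [->|Hne].
  - destruct (HL phi) as [Hs Hf]; [now left|].
    apply (circulation_single p q A phi g e); auto.
    intros c Hd Hd' Hde. destruct (in_dec cell_eq c (map snd L)) as [Hi|Hi].
    + rewrite (H2 c Hi); lia.
    + rewrite Hh; auto; [lia|]. cbn; intros [|]; auto.
  - apply Hh; auto. cbn; intros [|]; auto.
Qed.

(* Each of the independent circulations in [L] allows one edge to be removed
   without disconnecting the tiles, so the rest has at least |A| - 1 edges. *)
Lemma circulations_bound p q A L :
  0 <= p -> 0 <= q -> NoDup A -> A <> [] -> connected (fun c => In c A) ->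
  (forall phi, In phi (map fst L) -> supported p q phi /\ flat A phi) ->
  triangular L ->
  (length A + length L <= length (links dirx A) + length (links diry A) + 1)%nat.
Proof.
  intros Hp Hq HA Hne Hc HL Ht.
  set (es := map snd L).
  set (E1 := filter (fun c => negb (mem c es)) (links dirx A)).
  destruct (merge_labels A (map (fun c => (c, shift dirx c)) E1 ++
                            map (fun c => (c, shift diry c)) (links diry A)) HA) as (f & Hf & Hlen).
  rewrite length_app, !length_map in Hlen.
  assert (length (es ++ E1) <= length (links dirx A))%nat as HE1.
  { apply NoDup_incl_length.
    - apply NoDup_app.
      + now apply triangular_NoDup.
      + apply NoDup_filter, NoDup_filter; auto.
      + intros c H1 H2. apply filter_In in H2 as [_ H2].
        apply Bool.negb_true_iff, memPn in H2; auto.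
    (* A pivot is a genuine edge between two tiles, since the jump vanishes at every missing
       cell. *)
    - intros c Hcc; apply in_app_iff in Hcc as [Hcc|Hcc].
      + destruct (triangular_jump L c Ht Hcc) as (phi & Hphi & Hj).
        destruct (HL phi Hphi) as [Hs Hfl]. destruct c as [x y].
        unfold jump in Hj; cbn [fst snd] in Hj.
        apply in_links; split.
        * destruct (in_dec cell_eq (x, y) A) as [|Hn]; auto.
          destruct (Hfl x y Hn) as (E & _ & E'). rewrite E, E' in Hj; lia.
        * replace (shift dirx (x, y)) with (x + 1, y) by (unfold shift; cbn; f_equal; lia).
          destruct (in_dec cell_eq (x + 1, y) A) as [|Hn]; auto.
          destruct (Hfl (x + 1) y Hn) as (_ & E & _). rewrite E in Hj; lia.
      + now apply filter_In in Hcc. }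
  rewrite length_app in HE1. replace (length es) with (length L) in HE1
    by (unfold es; now rewrite length_map).
  destruct A as [|t0 A']; [contradiction|]. set (A := t0 :: A') in *.
  (* [g] indicates the class of [t0] after removal of the pivots. The circulations make it constant
     on [A], so only one class is left. *)
  set (g := fun c => if cell_eq (f c) (f t0) then 1 else 0).
  assert (Hgf : forall a b, f a = f b -> g a = g b) by (unfold g; intros ? ? ->; auto).
  assert (Hv : forall c, In c A -> In (shift diry c) A -> g (shift diry c) = g c).
  { intros c H1 H2. symmetry; apply Hgf, Hf, in_app_iff; right.
    apply in_map_iff; exists c; split; auto. now apply in_links. }
  assert (Hh : forall c, In c A -> In (shift dirx c) A -> g (shift dirx c) = g c).
  { apply (triangular_kill p q A g L); auto.
    intros c H1 H2 H3. symmetry; apply Hgf, Hf, in_app_iff; left.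
    apply in_map_iff; exists c; split; auto. apply filter_In; split.
    - now apply in_links.
    - now apply Bool.negb_true_iff, memPn. }
  assert (Hg : forall c, In c A -> g c = 1).
  { intros c Hcc. apply (path_inv (fun c => In c A) (fun c => g c = 1) t0 c).
    - intros a b Ha HSa HSb Hab.
      apply adj_shift in Hab as [-> | [-> | [-> | ->]]].
      + now rewrite Hh.
      + now rewrite <- Hh.
      + now rewrite Hv.
      + now rewrite <- Hv.
    - apply Hc; auto. now left.
    - unfold g; destruct (cell_eq (f t0) (f t0)); congruence. }
  assert (length (nodup cell_eq (map f A)) <= length [f t0])%nat as Hone.
  { apply NoDup_incl_length; [apply NoDup_nodup|].
    intros c Hcc; rewrite nodup_In in Hcc; apply in_map_iff in Hcc as (v & <- & Hvv).
    specialize (Hg v Hvv). unfold g in Hg.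
    destruct (cell_eq (f v) (f t0)) as [->|]; [now left | discriminate]. }
  cbn [length] in Hone. lia.
Qed.

(** * Rays, holes and the bounding box *)

Definition ray (c v : cell) (k : Z) : cell := (fst c + k * fst v, snd c + k * snd v).

Definition unit_vec (v : cell) : Prop := v = (1, 0) \/ v = (-1, 0) \/ v = (0, 1) \/ v = (0, -1).

Ltac units H := destruct H as [-> | [-> | [-> | ->]]]; unfold ray, shift, dirx, diry, adj in *; cbn [fst snd] in *.

Lemma ray_path (S : cell -> Prop) c v n :
  unit_vec v -> (forall k, 0 <= k <= Z.of_nat n -> S (ray c v k)) ->
  path_in S c (ray c v (Z.of_nat n)).
Proof.
  intros Hv; induction n as [|n IH]; intros HS.
  - assert (ray c v (Z.of_nat 0) = c) as E by (destruct c; units Hv; f_equal; lia).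
    rewrite E. constructor. rewrite <- E. apply HS; lia.
  - apply path_trans with (ray c v (Z.of_nat n)).
    + apply IH; intros; apply HS; lia.
    + apply path_one; try (apply HS; lia). units Hv; lia.
Qed.

(** Otherwise the whole ray would belong to the hole, which fits into a finite list. *)
Lemma hole_hits A r v :
  hole_cell A r -> unit_vec v ->
  exists k, 1 <= k /\ In (ray r v k) A /\ (forall i, 0 <= i < k -> outside A (ray r v i)) /\
    path_in (outside A) r (ray r v (k - 1)).
Proof.
  intros [Hout [L HL]] Hv.
  assert (H : forall n : nat,
    (exists k, 1 <= k /\ In (ray r v k) A /\ (forall i, 0 <= i < k -> outside A (ray r v i)) /\
      path_in (outside A) r (ray r v (k - 1))) \/
    (forall k, 0 <= k <= Z.of_nat n -> outside A (ray r v k))).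
  { induction n as [|n [IH|IH]]; [right | now left |].
    - intros k Hk. replace (ray r v k) with r; auto.
      destruct r; units Hv; f_equal; lia.
    - destruct (in_dec cell_eq (ray r v (Z.of_nat (S n))) A) as [Hi|Hi].
      + left; exists (Z.of_nat (S n)); split; [lia|]; split; auto.
        split; [intros; apply IH; lia|].
        replace (Z.of_nat (S n) - 1) with (Z.of_nat n) by lia.
        apply ray_path; auto.
      + right; intros k Hk. destruct (Z.eq_dec k (Z.of_nat (S n))) as [->|]; auto.
        apply IH; lia. }
  destruct (H (length L)) as [|Hall]; auto. exfalso.
  assert (length (map (ray r v) (zrange 0 (S (length L)))) <= length L)%nat as Hlen.
  { apply NoDup_incl_length.
    - apply NoDup_map_inj; [|apply NoDup_zrange].
      intros a b _ _ E; units Hv; injection E; lia.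
    - intros c Hc; apply in_map_iff in Hc as (k & <- & Hk); apply in_zrange in Hk.
      apply HL. replace k with (Z.of_nat (Z.to_nat k)) by lia.
      apply ray_path; auto. intros i Hi; apply Hall; lia. }
  rewrite length_map, length_zrange in Hlen; lia.
Qed.

Lemma hole_cell_path A a b : hole_cell A a -> path_in (outside A) a b -> hole_cell A b.
Proof.
  intros [Ha [L HL]] Hp; split; [now apply path_end in Hp|].
  exists L; intros c Hc; apply HL. eapply path_trans; eauto.
Qed.

(** A discrete intermediate value theorem; it shows that every row and column of the bounding box
    contains a tile. *)
Lemma path_intermediate (S : cell -> Prop) (u : cell -> Z) a b y :
  (forall c d, adj c d -> Z.abs (u c - u d) <= 1) ->
  path_in S a b -> u a <= y <= u b -> exists c, S c /\ u c = y.
Proof.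
  intros Hu; induction 1 as [p Hp|p q r Hp Hpq Hqr IH]; intros Hy.
  - exists p; split; auto; lia.
  - destruct (Z.eq_dec (u p) y) as [|]; [exists p; auto|].
    apply IH. specialize (Hu p q Hpq); lia.
Qed.

Lemma list_extremum {A} (u : A -> Z) l :
  l <> [] -> exists m, In m l /\ forall c, In c l -> u m <= u c.
Proof.
  induction l as [|a l IH]; [congruence|]; intros _.
  destruct l as [|b l].
  - exists a; split; [now left|]. intros c [<-|[]]; lia.
  - destruct IH as (m & Hm & Hmin); [discriminate|].
    destruct (Z_le_gt_dec (u a) (u m)).
    + exists a; split; [now left|]. intros c [<-|Hc]; [lia|]. specialize (Hmin c Hc); lia.
    + exists m; split; [now right|]. intros c [<-|Hc]; [lia|]. now apply Hmin.
Qed.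

(* Besides the last tile of every line in direction [d], every hole is bounded
   by a tile whose [d]-neighbour is empty. *)
Lemma links_bound A reps d (u : cell -> Z) (y0 : Z) (b : nat) :
  NoDup A -> (d = dirx /\ u = snd \/ d = diry /\ u = fst) ->
  NoDup reps -> (forall r, In r reps -> hole_cell A r) ->
  (forall r1 r2, In r1 reps -> In r2 reps -> path_in (outside A) r1 r2 -> r1 = r2) ->
  (forall y, y0 <= y < y0 + Z.of_nat b -> exists t, In t A /\ u t = y) ->
  (length (links d A) + length reps + b <= length A)%nat.
Proof.
  intros HA Hd Hnd Hhole Hsep Hrow.
  assert (Hv : unit_vec (- fst d, - snd d)) by (unfold unit_vec; destruct Hd as [[-> _]|[-> _]]; cbn; auto).
  assert (Hvd : unit_vec d) by (unfold unit_vec; destruct Hd as [[-> _]|[-> _]]; cbn; auto).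
  set (R := filter (fun c => negb (mem (shift d c) A)) A).
  assert (HR : forall c, In c R <-> In c A /\ ~ In (shift d c) A).
  { intros c; unfold R; now rewrite filter_In, Bool.negb_true_iff, memPn. }
  (* A hole is charged to a tile whose [d]-neighbour lies in it, a line to its last tile in
     direction [d]. *)
  set (P := fun (s : cell + Z) t => match s with
    | inl r => path_in (outside A) r (shift d t)
    | inr y => u t = y /\ forall k, 1 <= k -> ~ In (ray t d k) A end).
  assert (Hlen : (length (map (@inl cell Z) reps ++ map inr (zrange y0 b)) <= length R)%nat).
  { apply (length_le_rel P).
    - apply NoDup_app.
      + apply NoDup_map_inj; auto. intros; congruence.
      + apply NoDup_map_inj; [intros; congruence | apply NoDup_zrange].
      + intros s H1 H2. apply in_map_iff in H1 as (? & <- & _).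
        apply in_map_iff in H2 as (? & ? & _); discriminate.
    - intros s Hs; apply in_app_iff in Hs as [Hs|Hs]; apply in_map_iff in Hs as (r & <- & Hr).
      + destruct (hole_hits A r _ (Hhole r Hr) Hv) as (k & Hk & Hin & _ & Hp).
        exists (ray r (- fst d, - snd d) k).
        assert (shift d (ray r (- fst d, - snd d) k) = ray r (- fst d, - snd d) (k - 1)) as E.
        { destruct Hd as [[-> _]|[-> _]]; unfold shift, ray, dirx, diry; cbn [fst snd]; f_equal; lia. }
        split.
        * apply HR; split; auto. rewrite E. now apply path_end in Hp.
        * cbn; now rewrite E.
      + apply in_zrange in Hr. destruct (Hrow r Hr) as (t & Ht & Hut).
        destruct (list_extremum (fun c => - (fst d * fst c + snd d * snd c))
                    (filter (fun c => u c =? r) A)) as (m & Hm & Hmax).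
        { intros E. assert (In t (filter (fun c => u c =? r) A)) as F.
          - apply filter_In; split; auto. lia.
          - rewrite E in F; destruct F. }
        apply filter_In in Hm as [Hm Hum].
        assert (Hk : forall k, 1 <= k -> ~ In (ray m d k) A).
        { intros k Hk Hin. assert (In (ray m d k) (filter (fun c => u c =? r) A)) as F.
          - apply filter_In; split; auto.
            destruct Hd as [[-> ->]|[-> ->]]; unfold ray, dirx, diry; cbn [fst snd]; lia.
          - apply Hmax in F. destruct Hd as [[-> _]|[-> _]]; unfold ray, dirx, diry in F; cbn [fst snd] in F; lia. }
        exists m; split; [|split; auto; lia].
        apply HR; split; auto.
        replace (shift d m) with (ray m d 1); [apply Hk; lia|].
        unfold shift, ray; f_equal; lia.
    (* The last tile of a line is never charged to a hole: from inside the hole, a ray in direction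
       [d] would meet a later tile of the same line. *)
    - assert (Hmix : forall r y t, In r reps -> P (inl r) t -> P (inr y) t -> False).
      { intros r y t Hr H1 [_ H2]; cbn in H1.
        pose proof (hole_cell_path A r _ (Hhole r Hr) H1) as Hh.
        destruct (hole_hits A _ d Hh Hvd) as (k & Hk & Hin & _).
        apply (H2 (k + 1)); [lia|].
        replace (ray t d (k + 1)) with (ray (shift d t) d k); auto.
        unfold shift, ray; cbn [fst snd]; f_equal; lia. }
      intros [r|y] [r'|y'] t H1 H2 P1 P2.
      + f_equal. apply in_app_iff in H1 as [H1|H1], H2 as [H2|H2].
        * apply in_map_iff in H1 as (? & E1 & H1), H2 as (? & E2 & H2).
          injection E1 as ->; injection E2 as ->.
          apply Hsep; auto. apply path_trans with (shift d t); auto using path_sym.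
        * apply in_map_iff in H2 as (? & ? & _); discriminate.
        * apply in_map_iff in H1 as (? & ? & _); discriminate.
        * apply in_map_iff in H1 as (? & ? & _); discriminate.
      + exfalso. apply (Hmix r y' t); auto.
        apply in_app_iff in H1 as [H1|H1]; apply in_map_iff in H1 as (? & E & H1);
          [injection E as ->; auto | discriminate].
      + exfalso. apply (Hmix r' y t); auto.
        apply in_app_iff in H2 as [H2|H2]; apply in_map_iff in H2 as (? & E & H2);
          [injection E as ->; auto | discriminate].
      + f_equal. destruct P1 as [<- _], P2 as [<- _]; auto. }
  rewrite length_app, !length_map, length_zrange in Hlen.
  pose proof (filter_split (fun c => mem (shift d c) A) A) as H; cbn beta in H.
  fold (links d A) in H. fold R in H. lia.
Qed.

Lemma bounding_box A h :
  is_polyomino A -> num_holes A h ->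
  exists x0 y0 (a b : nat), (1 <= a)%nat /\ (1 <= b)%nat /\
    (forall c, In c A -> x0 <= fst c < x0 + Z.of_nat a /\ y0 <= snd c < y0 + Z.of_nat b) /\
    (length A + h <= a * b)%nat /\
    (length (links dirx A) + h + b <= length A)%nat /\
    (length (links diry A) + h + a <= length A)%nat.
Proof.
  intros (HA & Hne & Hc) (reps & <- & Hnd & Hhole & Hsep & _).
  destruct (list_extremum fst A Hne) as (l & Hl & Hlm).
  destruct (list_extremum (fun c => - fst c) A Hne) as (r & Hr & Hrm).
  destruct (list_extremum snd A Hne) as (d & Hd & Hdm).
  destruct (list_extremum (fun c => - snd c) A Hne) as (t & Ht & Htm).
  cbn beta in *. pose proof (Hlm r Hr) as Hlr. pose proof (Hdm t Ht) as Hdt.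
  exists (fst l), (snd d), (Z.to_nat (fst r - fst l + 1)), (Z.to_nat (snd t - snd d + 1)).
  assert (Hbox : forall c, In c A -> fst l <= fst c <= fst r /\ snd d <= snd c <= snd t).
  { intros c Hcc. specialize (Hlm c Hcc); specialize (Hrm c Hcc);
    specialize (Hdm c Hcc); specialize (Htm c Hcc); lia. }
  split; [lia|]; split; [lia|]; split; [|split; [|split]].
  - intros c Hcc; specialize (Hbox c Hcc); lia.
  - rewrite <- length_app, <- (length_zbox (fst l) (snd d)).
    apply NoDup_incl_length.
    + apply NoDup_app; auto. intros c H1 H2. now apply (Hhole c H2).
    + intros c Hcc; apply in_zbox. apply in_app_iff in Hcc as [Hcc|Hcc].
      * specialize (Hbox c Hcc); lia.
      * destruct (hole_hits A c (1, 0)) as (k & _ & Hin & _); auto; [now left|].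
        destruct (hole_hits A c (0, 1)) as (k' & _ & Hin' & _); auto; [right; right; now left|].
        apply Hbox in Hin, Hin'. unfold ray in *; cbn [fst snd] in *; lia.
  - apply (links_bound A reps dirx snd (snd d)); auto.
    intros y Hy. apply (path_intermediate _ snd d t); auto; [unfold adj; lia | lia].
  - apply (links_bound A reps diry fst (fst l)); auto.
    intros y Hy. apply (path_intermediate _ fst l r); auto; [unfold adj; lia | lia].
Qed.

(** * Boxes with some cells removed *)

Definition board (p q : Z) (E : list cell) : cell -> Prop :=
  fun c => 0 <= fst c <= p /\ 0 <= snd c <= q /\ ~ In c E.

Definition tiles (p q : Z) (E : list cell) : list cell :=
  filter (fun c => negb (mem c E)) (zbox 0 0 (Z.to_nat (p + 1)) (Z.to_nat (q + 1))).

Lemma in_tiles p q E c : In c (tiles p q E) <-> board p q E c.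
Proof.
  unfold tiles, board; rewrite filter_In, in_zbox, Bool.negb_true_iff, memPn.
  split; intros (? & ?); repeat split; try tauto; lia.
Qed.

Lemma NoDup_tiles p q E : NoDup (tiles p q E).
Proof. apply NoDup_filter, NoDup_zbox. Qed.

Lemma length_tiles p q E :
  0 <= p -> 0 <= q -> NoDup E ->
  (forall c, In c E -> 0 <= fst c <= p /\ 0 <= snd c <= q) ->
  Z.of_nat (length (tiles p q E)) + Z.of_nat (length E) = (p + 1) * (q + 1).
Proof.
  intros Hp Hq HE Hbox.
  set (B := zbox 0 0 (Z.to_nat (p + 1)) (Z.to_nat (q + 1))).
  assert (length (filter (fun c => mem c E) B) = length E) as H.
  { apply Nat.le_antisymm; apply NoDup_incl_length; auto.
    - apply NoDup_filter, NoDup_zbox.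
    - intros c Hc; apply filter_In in Hc as [_ Hc]; now apply memP.
    - intros c Hc; apply filter_In; split; [|now apply memP].
      apply in_zbox; specialize (Hbox c Hc); lia. }
  pose proof (filter_split (fun c => mem c E) B) as H'; cbn beta in H'.
  change (filter (fun x => negb (mem x E)) B) with (tiles p q E) in H'.
  pose proof (length_zbox 0 0 (Z.to_nat (p + 1)) (Z.to_nat (q + 1))) as H''.
  fold B in H''. apply (f_equal Z.of_nat) in H''.
  rewrite Nat2Z.inj_mul, !Z2Nat.id in H'' by lia. lia.
Qed.

(** [H] collects the holes and [K] the deleted boundary cells. Separation from both keeps every hole
    a single cell and prevents deletions from opening it. *)
Definition isolated (p q : Z) (H K : list cell) : Prop :=
  forall c, In c H -> 1 <= fst c <= p - 1 /\ 1 <= snd c <= q - 1 /\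
    forall d, adj c d -> ~ In d (H ++ K).

(** A cell of [H] is enclosed by tiles. Every other empty cell lies on a side of the box or beyond
    it, so an outward ray from it never meets a tile. *)
Lemma num_holes_tiles p q H K :
  NoDup H -> isolated p q H K ->
  (forall c, In c K -> ~ In c H /\ (fst c = 0 \/ fst c = p \/ snd c = 0 \/ snd c = q)) ->
  num_holes (tiles p q (H ++ K)) (length H).
Proof.
  intros Hnd Hiso HK.
  assert (Hout : forall c, In c H -> outside (tiles p q (H ++ K)) c).
  { intros c Hc; unfold outside; rewrite in_tiles; unfold board; rewrite in_app_iff; tauto. }
  assert (Hstuck : forall r c, In r H -> path_in (outside (tiles p q (H ++ K))) r c -> c = r).
  { intros r c Hr Hp. apply (path_inv (outside (tiles p q (H ++ K))) (fun c => c = r) r c); auto.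
    intros a b -> _ Hb Hab. exfalso; apply Hb, in_tiles.
    destruct (Hiso r Hr) as (H1 & H2 & H3).
    unfold adj in Hab. unfold board; repeat split; try lia. now apply H3. }
  exists H; split; [reflexivity|]; split; [auto|]; split; [|split].
  - intros r Hr; split; auto.
    exists [r]; intros c Hc; left; symmetry; eauto.
  - intros r1 r2 H1 H2 Hp; symmetry; eauto.
  - intros c Hc.
    destruct (in_dec cell_eq c H) as [Hin|Hn].
    + exists c; split; auto. constructor; auto.
    + exfalso.
      assert (Hesc : forall v, unit_vec v ->
        (forall k, 1 <= k -> ~ (0 <= fst (ray c v k) <= p /\ 0 <= snd (ray c v k) <= q)) -> False).
      { intros v Hv Hk. destruct (hole_hits _ c v Hc Hv) as (k & Hk1 & Hin & _).
        apply in_tiles in Hin as (Hx & Hy & _). apply (Hk k); auto. }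
      assert (fst c <= 0 \/ p <= fst c \/ snd c <= 0 \/ q <= snd c) as Hside.
      { destruct Hc as [Hc _]. unfold outside in Hc; rewrite in_tiles in Hc; unfold board in Hc.
        destruct (in_dec cell_eq c K) as [Hk|Hk].
        - destruct (HK c Hk) as [_ HK']; lia.
        - assert (~ In c (H ++ K)) by (rewrite in_app_iff; tauto).
          destruct (Z_lt_le_dec 0 (fst c)); [|lia].
          destruct (Z_lt_le_dec (fst c) p); [|lia].
          destruct (Z_lt_le_dec 0 (snd c)); [|lia].
          destruct (Z_lt_le_dec (snd c) q); [|lia].
          exfalso; apply Hc; repeat split; auto; lia. }
      unfold ray in Hesc.
      destruct Hside as [Hs|[Hs|[Hs|Hs]]].
      * apply (Hesc (-1, 0)); cbn [fst snd]; [unfold unit_vec; auto|intros; lia].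
      * apply (Hesc (1, 0)); cbn [fst snd]; [unfold unit_vec; auto|intros; lia].
      * apply (Hesc (0, -1)); cbn [fst snd]; [unfold unit_vec; auto|intros; lia].
      * apply (Hesc (0, 1)); cbn [fst snd]; [unfold unit_vec; auto|intros; lia].
Qed.

Lemma connected_box p q : connected (board p q []).
Proof.
  intros [x1 y1] [x2 y2] (Hx1 & Hy1 & _) (Hx2 & Hy2 & _); cbn [fst snd] in *.
  assert (Hb : forall x y, 0 <= x <= p -> 0 <= y <= q -> board p q [] (x, y))
    by (intros; unfold board; cbn; tauto).
  apply path_trans with (x2, y1).
  - apply hline; intros; apply Hb; lia.
  - apply vline; intros; apply Hb; lia.
Qed.

(* Filling every cell of the box except one representative per hole. *)
Lemma fill_box p q A h :
  is_polyomino A -> num_holes A h ->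
  (forall c, In c A -> 0 <= fst c <= p /\ 0 <= snd c <= q) ->
  exists H, NoDup H /\ length H = h /\ isolated p q H [] /\ connected (board p q H).
Proof.
  intros (HA & Hne & Hcon) (H & Hlen & Hnd & Hhole & Hsep & Hcov) Hbox.
  exists H; split; [auto|]; split; [auto|].
  assert (HoutH : forall c, In c H -> ~ In c A) by (intros c Hc; apply (Hhole c Hc)).
  assert (HAb : forall c, In c A -> board p q H c).
  { intros c Hc; destruct (Hbox c Hc); repeat split; try lia.
    intros Hc'; now apply (HoutH c). }
  split.
  - intros r Hr. repeat split.
    1-4: match goal with
      | |- 1 <= fst _ => destruct (hole_hits A r (-1, 0) (Hhole r Hr)) as (k & Hk & Hin & _)
      | |- fst _ <= _ => destruct (hole_hits A r (1, 0) (Hhole r Hr)) as (k & Hk & Hin & _)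
      | |- 1 <= snd _ => destruct (hole_hits A r (0, -1) (Hhole r Hr)) as (k & Hk & Hin & _)
      | |- snd _ <= _ => destruct (hole_hits A r (0, 1) (Hhole r Hr)) as (k & Hk & Hin & _)
      end; [unfold unit_vec; tauto | apply Hbox in Hin; unfold ray in Hin; cbn [fst snd] in Hin; lia].
    rewrite app_nil_r; intros d Hd Hin.
    assert (r = d) as <-.
    { apply Hsep; auto. apply path_one; auto; [apply (Hhole r Hr) | apply (Hhole d Hin)]. }
    unfold adj in Hd; lia.
  (* A filled cell of a hole leaves along a ray that misses the representative. Any other filled
     cell walks through the full box until it meets [A]; up to then the walk stays outside all holes
     and so avoids [H]. *)
  - assert (Hreach : forall c, board p q H c -> exists a, In a A /\ path_in (board p q H) c a).
    { intros c Hc.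
      destruct (in_dec cell_eq c A) as [Hin|Hn]; [exists c; split; auto; now constructor|].
      destruct (classic (hole_cell A c)) as [Hh|Hh].
      - destruct (Hcov c Hh) as (r & Hr & Hrc).
        assert (exists v, unit_vec v /\ forall k, 0 <= k -> ray c v k <> r) as (v & Hv & Hvr).
        { assert (r <> c) by (intros ->; now apply Hc).
          destruct (Z.eq_dec (snd r) (snd c)) as [E|E].
          - exists (0, 1); split; [unfold unit_vec; auto|]. intros k Hk E'.
            apply (f_equal fst) in E'; unfold ray in E'; cbn [fst snd] in E'.
            assert (r = c); auto. destruct r, c; cbn in *; f_equal; lia.
          - exists (1, 0); split; [unfold unit_vec; auto|]. intros k Hk E'.
            apply (f_equal snd) in E'; unfold ray in E'; cbn [fst snd] in E'. lia. }
        destruct (hole_hits A c v Hh Hv) as (k & Hk & Hin & Hi & _).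
        exists (ray c v k); split; auto.
        replace k with (Z.of_nat (Z.to_nat k)) in * by lia.
        set (n := Z.to_nat k) in *.
        apply ray_path; auto. intros i Hi'.
        destruct (Z.eq_dec i (Z.of_nat n)) as [->|Hne']; [now apply HAb|].
        destruct Hc as (Hx & Hy & _). apply Hbox in Hin.
        repeat split.
        1-4: units Hv; lia.
        intros HiH. apply (Hvr i); [lia|].
        apply Hsep; auto. apply path_sym. apply path_trans with c; auto.
        replace i with (Z.of_nat (Z.to_nat i)) by lia.
        apply ray_path; auto. intros j Hj; apply Hi; lia.
      - destruct A as [|a0 A']; [contradiction|]. set (A := a0 :: A') in *.
        assert (Hp : path_in (board p q []) c a0).
        { apply connected_box.
          - destruct Hc as (? & ? & _); repeat split; cbn; tauto.
          - destruct (Hbox a0); [now left|]; repeat split; cbn; tauto. }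
        assert (Ha0 : In a0 A) by now left. clearbody A.
        revert Hn Hh Hc. induction Hp as [b Hb|b c d Hb Hbc Hcd IH]; intros Hn Hh Hc; [contradiction|].
        destruct (in_dec cell_eq c A) as [Hin|Hn'].
        + exists c; split; auto. apply path_one; auto.
        + assert (Hh' : ~ hole_cell A c).
          { intros Hx; apply Hh, (hole_cell_path A c); auto. apply path_one; auto using adj_sym. }
          assert (Hc' : board p q H c).
          { pose proof (path_start _ _ _ Hcd) as (? & ? & _). repeat split; try lia.
            intros Hx; apply Hh'; auto. }
          destruct (IH Ha0 Hn' Hh' Hc') as (a & Ha & Hpa).
          exists a; split; auto. now apply path_step with c. }
    intros a b Ha Hb.
    destruct (Hreach a Ha) as (a' & Ha' & Pa), (Hreach b Hb) as (b' & Hb' & Pb).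
    apply path_trans with a'; auto. apply path_trans with b'; [|now apply path_sym].
    apply path_mono with (S := fun c => In c A); auto.
Qed.

(* The tile graph of the box minus [H] has cyclomatic number [p*q - 3*|H|]. *)
Lemma labels_bound p q H L :
  1 <= p -> 1 <= q -> NoDup H -> isolated p q H [] -> connected (board p q H) ->
  (forall phi, In phi (map fst L) -> supported p q phi /\
    forall x y, In (x, y) H -> phi (x + 1) y = phi x y /\ phi x (y + 1) = phi x y /\
      phi (x + 1) (y + 1) = phi x y) ->
  triangular L ->
  Z.of_nat (length L) + 3 * Z.of_nat (length H) <= p * q.
Proof.
  intros Hp Hq Hnd Hiso Hcon HL Ht.
  assert (HA : is_polyomino (tiles p q H)).
  { split; [apply NoDup_tiles|]; split.
    - intros E. assert (In (0, 0) (tiles p q H)) as Hin; [|rewrite E in Hin; destruct Hin].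
      apply in_tiles; repeat split; cbn; try lia.
      intros Hin; apply Hiso in Hin; cbn in Hin; lia.
    - intros a b Ha Hb. apply path_mono with (S := board p q H).
      + intros c; apply in_tiles.
      + apply Hcon; now apply in_tiles. }
  assert (HN : num_holes (tiles p q H) (length H)).
  { rewrite <- (app_nil_r H) at 1. apply num_holes_tiles; auto. intros c []. }
  destruct (bounding_box _ _ HA HN) as (x0 & y0 & a & b & _ & _ & Hbox & _ & Hex & Hey).
  destruct HA as (HA1 & HA2 & HA3).
  pose proof (circulations_bound p q (tiles p q H) L ltac:(lia) ltac:(lia) HA1 HA2 HA3) as HC.
  assert (length (tiles p q H) + length L <=
    length (links dirx (tiles p q H)) + length (links diry (tiles p q H)) + 1)%nat as HC'.
  { apply HC; auto. intros phi Hphi; destruct (HL phi Hphi) as [Hs Hf]; split; auto.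
    intros x y Hn. destruct (in_dec cell_eq (x, y) H) as [Hin|Hin]; auto.
    assert (Hz : forall x y, ~ (1 <= x <= p /\ 1 <= y <= q) -> phi x y = 0).
    { intros u v Huv; destruct (Z.eq_dec (phi u v) 0); auto; exfalso; auto. }
    (* All corners of a cell outside the box are vertices where [phi] vanishes. *)
    assert (~ (0 <= x <= p /\ 0 <= y <= q)).
    { intros Hxy; apply Hn, in_tiles; repeat split; auto; cbn; lia. }
    rewrite !Hz; auto; lia. }
  assert (Hlen : Z.of_nat (length (tiles p q H)) + Z.of_nat (length H) = (p + 1) * (q + 1)).
  { apply length_tiles; auto; try lia. intros c Hc; apply Hiso in Hc; lia. }
  assert (H00 : In (0, 0) (tiles p q H)).
  { apply in_tiles; repeat split; cbn; try lia. intros Hin; apply Hiso in Hin; cbn in Hin; lia. }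
  assert (Hpq : In (p, q) (tiles p q H)).
  { apply in_tiles; repeat split; cbn; try lia. intros Hin; apply Hiso in Hin; cbn in Hin; lia. }
  (* Two opposite corner tiles force the bounding box to span the whole box; the upper bounds on the
     edges then leave p*q - 3h. *)
  apply Hbox in H00, Hpq; cbn [fst snd] in *. lia.
Qed.

Ltac Zify.zify_post_hook ::= Z.div_mod_to_equations.

(** * Boxes with small cyclomatic number *)

Definition point (u v x y : Z) : Z := if (x =? u) && (y =? v) then 1 else 0.

Definition full (p q x y : Z) : Z :=
  if (1 <=? x) && (x <=? p) && (1 <=? y) && (y <=? q) then 1 else 0.

(** These are the four cells that meet at the vertex [(x, y)]. *)
Definition covered (H : list cell) (x y : Z) : Prop :=
  In (x - 1, y - 1) H \/ In (x, y - 1) H \/ In (x - 1, y) H \/ In (x, y) H.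

Ltac bool_lia :=
  repeat match goal with
  | |- context [?a =? ?b] => destruct (Z.eqb_spec a b)
  | |- context [?a <=? ?b] => destruct (Z.leb_spec a b)
  end; cbn; try lia.

Lemma point_same u v : point u v u v = 1.
Proof. unfold point; now rewrite !Z.eqb_refl. Qed.

Lemma point_other u v x y : x <> u \/ y <> v -> point u v x y = 0.
Proof. intros H; unfold point; bool_lia. Qed.

Lemma full_in p q x y : 1 <= x <= p -> 1 <= y <= q -> full p q x y = 1.
Proof. intros; unfold full; bool_lia. Qed.

Lemma full_out p q x y : ~ (1 <= x <= p /\ 1 <= y <= q) -> full p q x y = 0.
Proof. intros; unfold full; bool_lia. Qed.

Definition label (p q : Z) (H : list cell) (phi : Z -> Z -> Z) : Prop :=
  supported p q phi /\
  forall x y, In (x, y) H -> phi (x + 1) y = phi x y /\ phi x (y + 1) = phi x y /\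
    phi (x + 1) (y + 1) = phi x y.

Lemma point_label p q H u v :
  1 <= u <= p -> 1 <= v <= q -> ~ covered H u v -> label p q H (point u v).
Proof.
  intros Hu Hv Hc; split.
  - intros x y; unfold point; bool_lia.
  - intros x y Hin.
    assert (Hne : forall a b, (a = x \/ a = x + 1) -> (b = y \/ b = y + 1) -> point u v a b = 0).
    { intros a b Ha Hb. apply point_other.
      destruct (Z.eq_dec a u) as [<-|]; [|auto]. destruct (Z.eq_dec b v) as [<-|]; [|auto].
      exfalso; apply Hc; unfold covered.
      destruct Ha as [-> | ->], Hb as [-> | ->]; rewrite ?Z.add_simpl_r; tauto. }
    rewrite !Hne; auto.
Qed.

Lemma full_label p q H : isolated p q H [] -> label p q H (full p q).
Proof.
  intros Hiso; split.
  - intros x y; unfold full; bool_lia.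
  - intros x y Hin; apply Hiso in Hin; cbn [fst snd] in Hin. rewrite !full_in; auto; lia.
Qed.

Lemma cyclomatic_pos p q H :
  1 <= p -> 1 <= q -> NoDup H -> isolated p q H [] -> connected (board p q H) ->
  1 + 3 * Z.of_nat (length H) <= p * q.
Proof.
  intros Hp Hq Hnd Hiso Hcon.
  apply (labels_bound p q H [(full p q, (0, 0))]); auto.
  - intros phi [<-|[]]; now apply full_label.
  - cbn; unfold jump; cbn [fst snd]. rewrite full_in, full_out; try lia. repeat split; lia || easy.
Qed.

(** The two vertex indicators and the constant labelling are independent. The pivot of the latter is
    an edge of the bottom row at an abscissa different from [u] and [u'], which [3 <= p]
    provides. *)
Lemma two_uncovered p q H u v u' v' :
  3 <= p -> 1 <= q -> NoDup H -> isolated p q H [] -> connected (board p q H) ->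
  1 <= u <= p -> 1 <= v <= q -> ~ covered H u v ->
  1 <= u' <= p -> 1 <= v' <= q -> ~ covered H u' v' -> (u, v) <> (u', v') ->
  3 + 3 * Z.of_nat (length H) <= p * q.
Proof.
  intros Hp Hq Hnd Hiso Hcon Hu Hv Hc Hu' Hv' Hc' Hne.
  (* Of the two vertical grid sides ending at [(u, v)], one avoids [(u', v')]. *)
  assert (Hedge : forall u v u' v', (u, v) <> (u', v') -> exists e,
    jump (point u v) e <> 0 /\ jump (point u' v') e = 0).
  { clear; intros u v u' v' Hne.
    destruct (Z.eq_dec u u') as [<-|Hu]; [destruct (Z.eq_dec v' (v + 1)) as [->|Hv]|].
    - exists (u - 1, v - 1); unfold jump; cbn [fst snd].
      replace (u - 1 + 1) with u by lia; replace (v - 1 + 1) with v by lia.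
      rewrite point_same, !point_other; lia.
    - exists (u - 1, v); unfold jump; cbn [fst snd]. replace (u - 1 + 1) with u by lia.
      assert (v <> v') by congruence.
      rewrite point_same, !point_other; lia.
    - exists (u - 1, v); unfold jump; cbn [fst snd]. replace (u - 1 + 1) with u by lia.
      rewrite point_same, !point_other; lia. }
  destruct (Hedge u v u' v') as (e & He & _); auto.
  destruct (Hedge u' v' u v) as (e' & He' & He''); auto.
  assert (exists x, 1 <= x <= p /\ x <> u /\ x <> u') as (x & Hx & Hxu & Hxu').
  { destruct (Z.eq_dec 1 u), (Z.eq_dec 1 u'), (Z.eq_dec 2 u), (Z.eq_dec 2 u');
      solve [exists 1; lia | exists 2; lia | exists 3; lia]. }
  apply (labels_bound p q H [(point u v, e); (point u' v', e'); (full p q, (x - 1, 0))]);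
    auto; try lia.
  - intros phi [<-|[<-|[<-|[]]]]; [now apply point_label | now apply point_label | now apply full_label].
  - cbn. unfold jump in *; cbn [fst snd] in *.
    rewrite (full_in p q), (full_out p q); try lia.
    repeat split; try lia; auto.
    + intros c [<-|[<-|[]]]; auto. cbn [fst snd]. rewrite !point_other; lia.
    + intros c [<-|[]]. cbn [fst snd]. rewrite !point_other; lia.
Qed.

(** The pattern is forced from the left end: of two neighbours exactly one satisfies [P], so [P]
    holds precisely at the odd numbers. *)
Lemma alternating (P : Z -> Prop) n :
  ~ P 0 -> ~ P n -> (forall x, 0 <= x < n -> P x \/ P (x + 1)) ->
  (forall x, P x -> ~ P (x + 1)) -> 0 <= n -> n mod 2 = 0.
Proof.
  intros H0 Hn Hor Hnot Hpos.
  assert (forall k : nat, Z.of_nat k <= n -> (P (Z.of_nat k) <-> Z.of_nat k mod 2 = 1)) as H.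
  { induction k as [|k IH]; intros Hk.
    - split; [intros; contradiction | cbn; discriminate].
    - specialize (IH ltac:(lia)). specialize (Hor (Z.of_nat k) ltac:(lia)).
      specialize (Hnot (Z.of_nat k)).
      replace (Z.of_nat (S k)) with (Z.of_nat k + 1) by lia.
      assert (Z.of_nat k mod 2 = 0 \/ Z.of_nat k mod 2 = 1) as [E|E] by lia.
      + split; [intros _; lia|]. intros _. destruct Hor as [Hor|]; auto. apply IH in Hor; lia.
      + split; [|lia]. intros Hk1. exfalso; apply Hnot; auto. now apply IH. }
  specialize (H (Z.to_nat n) ltac:(lia)). rewrite Z2Nat.id in H by lia.
  assert (n mod 2 = 0 \/ n mod 2 = 1) as [E|E] by lia; auto.
  exfalso; apply Hn, H, E.
Qed.

Lemma covered_dec H x y : {covered H x y} + {~ covered H x y}.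
Proof.
  unfold covered.
  destruct (in_dec cell_eq (x - 1, y - 1) H); [left; auto|].
  destruct (in_dec cell_eq (x, y - 1) H); [left; auto|].
  destruct (in_dec cell_eq (x - 1, y) H); [left; auto|].
  destruct (in_dec cell_eq (x, y) H); [left; auto|]. right; tauto.
Defined.

Lemma find_range (P : Z -> Prop) (Pdec : forall x, {P x} + {~ P x}) n :
  0 <= n -> (exists x, 1 <= x <= n /\ ~ P x) \/ (forall x, 1 <= x <= n -> P x).
Proof.
  intros Hn. replace n with (Z.of_nat (Z.to_nat n)) by lia.
  induction (Z.to_nat n) as [|k IH]; [right; intros; lia|].
  destruct IH as [(x & ? & ?)|IH]; [left; exists x; split; auto; lia|].
  destruct (Pdec (Z.of_nat (S k))) as [|Hn']; [right|left; exists (Z.of_nat (S k)); split; auto; lia].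
  intros x Hx. destruct (Z.eq_dec x (Z.of_nat (S k))) as [->|]; auto. apply IH; lia.
Qed.

(** Cells on the sides of the box are no holes, so a vertex next to a side can touch only holes in
    one row or column. If all these vertices were covered, the holes there would alternate, against
    [alternating]. *)
Lemma boundary_uncovered p q H :
  2 <= p -> 2 <= q -> isolated p q H [] ->
  (p mod 2 = 1 ->
    exists x x', 1 <= x <= p /\ 1 <= x' <= p /\ ~ covered H x 1 /\ ~ covered H x' q) /\
  (q mod 2 = 1 ->
    exists y y', 1 <= y <= q /\ 1 <= y' <= q /\ ~ covered H 1 y /\ ~ covered H p y').
Proof.
  intros Hp Hq Hiso.
  assert (Hin : forall x y, In (x, y) H -> 1 <= x <= p - 1 /\ 1 <= y <= q - 1).
  { intros x y Hxy; apply Hiso in Hxy; cbn in Hxy; lia. }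
  assert (Hadj : forall c d, In c H -> adj c d -> ~ In d H).
  { intros c d Hc Hd; apply Hiso in Hc. rewrite app_nil_r in Hc; now apply Hc. }
  assert (Hrow : forall y0 y1, (y1 = 1 /\ y0 = 1 \/ y1 = q /\ y0 = q - 1) ->
     p mod 2 = 1 -> exists x, 1 <= x <= p /\ ~ covered H x y1).
  { intros y0 y1 Hy Hodd.
    destruct (find_range (fun x => covered H x y1) (fun x => covered_dec H x y1) p) as [|Hall];
      [lia|auto|]. exfalso.
    assert (p mod 2 = 0); [|lia].
    apply (alternating (fun x => In (x, y0) H)); try lia.
    - intros Hi; apply Hin in Hi; lia.
    - intros Hi; apply Hin in Hi; lia.
    - intros x Hx. specialize (Hall (x + 1) ltac:(lia)). unfold covered in Hall.
      replace (x + 1 - 1) with x in Hall by lia.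
      destruct Hy as [[-> ->]|[-> ->]].
      + destruct Hall as [Hi|[Hi|[Hi|Hi]]]; auto; apply Hin in Hi; lia.
      + destruct Hall as [Hi|[Hi|[Hi|Hi]]]; auto; apply Hin in Hi; lia.
    - intros x Hx; apply (Hadj _ _ Hx); unfold adj; cbn; lia. }
  assert (Hcol : forall x0 x1, (x1 = 1 /\ x0 = 1 \/ x1 = p /\ x0 = p - 1) ->
     q mod 2 = 1 -> exists y, 1 <= y <= q /\ ~ covered H x1 y).
  { intros x0 x1 Hx Hodd.
    destruct (find_range (fun y => covered H x1 y) (fun y => covered_dec H x1 y) q) as [|Hall];
      [lia|auto|]. exfalso.
    assert (q mod 2 = 0); [|lia].
    apply (alternating (fun y => In (x0, y) H)); try lia.
    - intros Hi; apply Hin in Hi; lia.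
    - intros Hi; apply Hin in Hi; lia.
    - intros y Hy. specialize (Hall (y + 1) ltac:(lia)). unfold covered in Hall.
      replace (y + 1 - 1) with y in Hall by lia.
      destruct Hx as [[-> ->]|[-> ->]].
      + destruct Hall as [Hi|[Hi|[Hi|Hi]]]; auto; apply Hin in Hi; lia.
      + destruct Hall as [Hi|[Hi|[Hi|Hi]]]; auto; apply Hin in Hi; lia.
    - intros y Hy; apply (Hadj _ _ Hy); unfold adj; cbn; lia. }
  split; intros Hodd.
  - destruct (Hrow 1 1) as (x & ? & ?); auto. destruct (Hrow (q - 1) q) as (x' & ? & ?); auto.
    exists x, x'; auto.
  - destruct (Hcol 1 1) as (x & ? & ?); auto. destruct (Hcol (p - 1) p) as (x' & ? & ?); auto.
    exists x, x'; auto.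
Qed.

Lemma cyclomatic_odd p q H :
  3 <= p -> 3 <= q -> p mod 2 = 1 \/ q mod 2 = 1 ->
  NoDup H -> isolated p q H [] -> connected (board p q H) ->
  3 + 3 * Z.of_nat (length H) <= p * q.
Proof.
  intros Hp Hq Hodd Hnd Hiso Hcon.
  destruct (boundary_uncovered p q H ltac:(lia) ltac:(lia) Hiso) as [H1 H2].
  destruct Hodd as [Ho|Ho].
  - destruct (H1 Ho) as (x & x' & ? & ? & ? & ?).
    apply (two_uncovered p q H x 1 x' q); auto; try lia. intros E; injection E; lia.
  - destruct (H2 Ho) as (x & x' & ? & ? & ? & ?).
    apply (two_uncovered p q H 1 x p x'); auto; try lia. intros E; injection E; lia.
Qed.

(** Subtracting [phi 1 1] times the constant labelling leaves [psi], which vanishes at the vertex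
    (1, 1) and so has no jump at the pivot (0, 0) of the constant labelling. If [psi] were not zero,
    the two would be independent. *)
Lemma label_constant p q H phi :
  1 <= p -> 1 <= q -> NoDup H -> isolated p q H [] -> connected (board p q H) ->
  p * q = 3 * Z.of_nat (length H) + 1 -> label p q H phi ->
  forall x y, 1 <= x <= p -> 1 <= y <= q -> phi x y = phi 1 1.
Proof.
  intros Hp Hq Hnd Hiso Hcon Hpq [Hs Hf] x y Hx Hy.
  destruct (Z.eq_dec (phi x y) (phi 1 1)) as [|Hne]; auto. exfalso.
  assert (Hz : forall x y, ~ (1 <= x <= p /\ 1 <= y <= q) -> phi x y = 0).
  { intros a b H'; destruct (Z.eq_dec (phi a b) 0); auto; exfalso; auto. }
  set (psi := fun a b => phi a b - phi 1 1 * full p q a b).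
  assert (Hpsi0 : forall a b, ~ (1 <= a <= p /\ 1 <= b <= q) -> psi a b = 0).
  { intros a b H'; unfold psi. rewrite Hz, full_out; auto; lia. }
  (* Going up the column from height 0, where [psi] is zero, some jump must be nonzero. *)
  assert (Hex : forall n : nat, psi x (Z.of_nat n) <> 0 -> exists e, jump psi e <> 0).
  { induction n as [|n IH]; intros Hn.
    - exfalso; apply Hn, Hpsi0; lia.
    - destruct (Z.eq_dec (psi x (Z.of_nat n)) 0) as [E|E]; auto.
      exists (x - 1, Z.of_nat n). unfold jump; cbn [fst snd].
      replace (x - 1 + 1) with x by lia. replace (Z.of_nat n + 1) with (Z.of_nat (S n)) by lia. lia. }
  destruct (Hex (Z.to_nat y)) as (e & He).
  { replace (Z.of_nat (Z.to_nat y)) with y by lia. unfold psi; rewrite full_in; auto; lia. }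
  assert (2 + 3 * Z.of_nat (length H) <= p * q); [|lia].
  apply (labels_bound p q H [(psi, e); (full p q, (0, 0))]); auto.
  - intros f [<-|[<-|[]]]; [|now apply full_label]. split.
    + intros a b Hab. destruct (Z_le_gt_dec 1 a), (Z_le_gt_dec a p), (Z_le_gt_dec 1 b),
        (Z_le_gt_dec b q); try lia; exfalso; apply Hab, Hpsi0; lia.
    + intros a b Hab. destruct (Hf a b Hab) as (E1 & E2 & E3).
      destruct (full_label p q H Hiso) as [_ Hfl]. destruct (Hfl a b Hab) as (F1 & F2 & F3).
      unfold psi; cbn [fst]; rewrite E1, E2, E3, F1, F2, F3; auto.
  - cbn; split; [auto|]; split; [|split; [|split; [|auto]]].
    + intros c [<-|[]]. unfold jump; cbn [fst snd]. rewrite (Hpsi0 (0 + 1) 0) by lia.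
      unfold psi; cbn [Z.add]. rewrite full_in; lia.
    + unfold jump; cbn [fst snd]. rewrite full_in, full_out; lia.
    + intros c [].
Qed.

(** * Boxes of cyclomatic number one *)

Definition half (c : cell) : cell := (fst c / 2, snd c / 2).

Definition even_cell (c : cell) : bool := (fst c mod 2 =? 0) && (snd c mod 2 =? 0).

Section Perfect.

Variables (p q : Z) (H : list cell).
Hypotheses (Hp : 2 <= p) (Hq : 2 <= q) (Hnd : NoDup H) (Hiso : isolated p q H [])
  (Hcon : connected (board p q H)) (Hpq : p * q = 3 * Z.of_nat (length H) + 1).

Lemma perfect_in x y : In (x, y) H -> 1 <= x <= p - 1 /\ 1 <= y <= q - 1.
Proof. intros Hxy; apply Hiso in Hxy; cbn in Hxy; lia. Qed.

Lemma perfect_adj c d : In c H -> adj c d -> ~ In d H.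
Proof. intros Hc Hd; apply Hiso in Hc. rewrite app_nil_r in Hc; now apply Hc. Qed.

Lemma perfect_covered x y : 1 <= x <= p -> 1 <= y <= q -> covered H x y.
Proof.
  intros Hx Hy. destruct (covered_dec H x y) as [|Hn]; auto. exfalso.
  assert (Hl : forall a b, 1 <= a <= p -> 1 <= b <= q -> point x y a b = point x y 1 1).
  { apply (label_constant p q H); auto; try lia. now apply point_label. }
  assert ((x = 1 /\ y = 1) \/ (x <> 1 \/ y <> 1)) as [[-> ->]|Hne] by lia.
  - specialize (Hl 2 1 ltac:(lia) ltac:(lia)). rewrite point_same, point_other in Hl; lia.
  - specialize (Hl x y Hx Hy). rewrite point_same, point_other in Hl; lia.
Qed.

Lemma perfect_corner : In (1, 1) H.
Proof.
  destruct (perfect_covered 1 1) as [Hi|[Hi|[Hi|Hi]]]; try lia; auto; apply perfect_in in Hi; lia.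
Qed.

(** Marks the vertices touching a hole of even colour. It is constant around each hole, because two
    cells of opposite colour at one vertex are adjacent and cannot both be holes. *)
Definition even_label (x y : Z) : Z :=
  if existsb (fun c => mem c H && ((fst c + snd c) mod 2 =? 0))
       [(x - 1, y - 1); (x, y - 1); (x - 1, y); (x, y)] then 1 else 0.

Lemma even_label_hole x y a b :
  In (x, y) H -> (a = x \/ a = x + 1) -> (b = y \/ b = y + 1) ->
  even_label a b = if (x + y) mod 2 =? 0 then 1 else 0.
Proof.
  intros Hin Ha Hb. unfold even_label.
  set (l := [(a - 1, b - 1); (a, b - 1); (a - 1, b); (a, b)]).
  assert (Hxy : In (x, y) l).
  { destruct Ha as [-> | ->], Hb as [-> | ->]; unfold l; rewrite ?Z.add_simpl_r; cbn; tauto. }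
  destruct ((x + y) mod 2 =? 0) eqn:E.
  - rewrite (proj2 (existsb_exists _ _)); auto.
    exists (x, y); split; auto. cbn [fst snd]. rewrite E, (proj2 (memP _ _)); auto.
  - destruct (existsb (fun c => mem c H && ((fst c + snd c) mod 2 =? 0)) l) eqn:F; auto. exfalso.
    apply existsb_exists in F as (c & Hc & F). apply andb_prop in F as [F1 F2].
    apply memP in F1. apply (perfect_adj _ c Hin); auto.
    assert (Hc' : (a - 1 <= fst c <= a) /\ b - 1 <= snd c <= b).
    { unfold l in Hc; cbn in Hc. destruct Hc as [<-|[<-|[<-|[<-|[]]]]]; cbn; lia. }
    unfold adj; cbn [fst snd]. lia.
Qed.

Lemma perfect_even x y : In (x, y) H -> (x + y) mod 2 = 0.
Proof.
  intros Hin.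
  assert (Hl : forall a b, 1 <= a <= p -> 1 <= b <= q -> even_label a b = even_label 1 1).
  { apply (label_constant p q H); auto; try lia. split.
    - intros a b Hab. unfold even_label in Hab.
      match type of Hab with (if ?b then _ else _) <> _ => destruct b eqn:F; [|lia] end.
      apply existsb_exists in F as (c & Hc & F). apply andb_prop in F as [F1 F2].
      apply memP in F1. cbn in Hc.
      destruct Hc as [<-|[<-|[<-|[<-|[]]]]]; apply perfect_in in F1; lia.
    - intros a b Hab. rewrite !(even_label_hole a b); auto. }
  pose proof (perfect_in x y Hin) as Hr.
  specialize (Hl x y ltac:(lia) ltac:(lia)).
  rewrite (even_label_hole x y), (even_label_hole 1 1) in Hl; auto using perfect_corner.
  destruct (Z.eqb_spec ((x + y) mod 2) 0); auto. cbn in Hl; discriminate.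
Qed.

(** The vertex [(p, 1)] can touch only the hole [(p - 1, 1)], whose even colour makes p even; the
    vertex [(1, q)] does the same for q. *)
Lemma perfect_parity : p mod 2 = 0 /\ q mod 2 = 0.
Proof.
  split.
  - destruct (perfect_covered p 1) as [Hi|[Hi|[Hi|Hi]]]; try lia; pose proof (perfect_in _ _ Hi);
      try lia; apply perfect_even in Hi; lia.
  - destruct (perfect_covered 1 q) as [Hi|[Hi|[Hi|Hi]]]; try lia; pose proof (perfect_in _ _ Hi);
      try lia; apply perfect_even in Hi; lia.
Qed.

(* A tile path starting at an odd-odd tile can never enter an even-even one:
   the two would be diagonal neighbours around an uncovered vertex. *)
Lemma perfect_odd_odd x y :
  0 <= x <= p -> 0 <= y <= q -> x mod 2 = 1 -> y mod 2 = 1 -> In (x, y) H.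
Proof.
  intros Hx Hy Hox Hoy.
  destruct (in_dec cell_eq (x, y) H) as [|Hn]; auto. exfalso.
  set (P := fun c : cell => (fst c mod 2 = 1 /\ snd c mod 2 = 1) \/
    ((fst c + snd c) mod 2 = 1 /\ exists w, adj c w /\ fst w mod 2 = 1 /\ snd w mod 2 = 1 /\
       board p q H w)).
  assert (P (0, 0)) as [[? _]|[? _]]; [|cbn in *; lia ..].
  apply (path_inv (board p q H) P (x, y)).
  - intros c d HPc Hc Hd Hcd. destruct HPc as [[Hc1 Hc2]|[Hc1 (w & Hw & Hw1 & Hw2 & Hw3)]].
    + right; split; [unfold adj in Hcd; lia|]. exists c; split; [now apply adj_sym|auto].
    + assert ((fst d mod 2 = 1 /\ snd d mod 2 = 1) \/ (fst d mod 2 = 0 /\ snd d mod 2 = 0))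
        as [Hd'|[Hd1 Hd2]] by (unfold adj in Hcd; lia); [now left|exfalso].
      destruct c as [c1 c2], d as [d1 d2], w as [w1 w2]; unfold board, adj in *; cbn [fst snd] in *.
      destruct Hd as (Hdx & Hdy & HdH), Hw3 as (Hwx & Hwy & HwH).
      assert ((w1 = d1 + 1 \/ d1 = w1 + 1) /\ (w2 = d2 + 1 \/ d2 = w2 + 1)) as [E1 E2] by lia.
      clear Hcd Hw.
      destruct (perfect_covered (Z.max w1 d1) (Z.max w2 d2)) as [Hi|[Hi|[Hi|Hi]]]; try lia;
      (destruct E1 as [-> | ->]; [rewrite Z.max_l in Hi by lia | rewrite Z.max_r in Hi by lia];
       (destruct E2 as [-> | ->]; [rewrite Z.max_l in Hi by lia | rewrite Z.max_r in Hi by lia]);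
       rewrite ?Z.add_simpl_r in Hi; try contradiction; apply perfect_even in Hi; lia).
  - apply Hcon; repeat split; cbn; try lia; auto.
    intros Hi; apply perfect_in in Hi; lia.
  - left; cbn; auto.
Qed.

Definition halves : list cell := map half (filter even_cell H).

Lemma in_halves u v : In (u, v) halves <-> In (2 * u, 2 * v) H.
Proof.
  unfold halves; rewrite in_map_iff; split.
  - intros ([x y] & E & Hi). apply filter_In in Hi as [Hi Hev].
    unfold even_cell, half in *; cbn [fst snd] in *.
    apply andb_prop in Hev as [E1 E2]. injection E as E3 E4.
    replace (2 * u) with x by lia. replace (2 * v) with y by lia. auto.
  - intros Hi; exists (2 * u, 2 * v); split.
    + unfold half; cbn [fst snd]; f_equal; lia.
    + apply filter_In; split; auto. unfold even_cell; cbn [fst snd].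
      apply andb_true_intro; split; lia.
Qed.

Lemma NoDup_halves : NoDup halves.
Proof.
  apply NoDup_map_inj; [|now apply NoDup_filter].
  intros [x y] [x' y'] H1 H2 E. apply filter_In in H1 as [_ H1], H2 as [_ H2].
  unfold even_cell, half in *; cbn [fst snd] in *.
  apply andb_prop in H1 as [? ?], H2 as [? ?]. injection E as E1 E2. f_equal; lia.
Qed.

(** An even hole is odd-odd or even-even, and every odd-odd cell is a hole. With this count the
    equation p*q = 3h + 1 reproduces itself for the half box. *)
Lemma length_halves : Z.of_nat (length H) = (p / 2) * (q / 2) + Z.of_nat (length halves).
Proof.
  pose proof perfect_parity as [Hp2 Hq2].
  set (B := map (fun c => (2 * fst c + 1, 2 * snd c + 1))
              (zbox 0 0 (Z.to_nat (p / 2)) (Z.to_nat (q / 2)))).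
  assert (HB : length (filter (fun c => negb (even_cell c)) H) = length B).
  { apply Nat.le_antisymm; apply NoDup_incl_length.
    - now apply NoDup_filter.
    - intros [x y] Hi; apply filter_In in Hi as [Hi Hev].
      pose proof (perfect_even x y Hi). apply perfect_in in Hi.
      unfold even_cell in Hev; cbn [fst snd] in Hev.
      assert (x mod 2 = 1 /\ y mod 2 = 1) as [? ?].
      { destruct (Z.eqb_spec (x mod 2) 0), (Z.eqb_spec (y mod 2) 0); cbn in Hev; try discriminate; lia. }
      apply in_map_iff; exists (x / 2, y / 2); cbn [fst snd]; split; [f_equal; lia|].
      apply in_zbox; cbn [fst snd]; lia.
    - apply NoDup_map_inj; [|apply NoDup_zbox].
      intros [a b] [a' b'] _ _ E; cbn [fst snd] in E. apply pair_equal_spec in E as [E1 E2]. f_equal; lia.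
    - intros c Hi; apply in_map_iff in Hi as ([a b] & <- & Hi); apply in_zbox in Hi.
      cbn [fst snd] in *. apply filter_In; split.
      + apply perfect_odd_odd; lia.
      + unfold even_cell; cbn [fst snd].
        destruct (Z.eqb_spec ((2 * a + 1) mod 2) 0); cbn; auto; lia. }
  pose proof (filter_split even_cell H) as Hs.
  unfold halves; rewrite length_map, <- Hs, HB.
  unfold B; rewrite length_map, length_zbox, Nat2Z.inj_add, Nat2Z.inj_mul, !Z2Nat.id; lia.
Qed.

(** If two even-even holes were at distance two, the tile between them would be enclosed by these
    two and two odd-odd holes, cut off from the corner [(0, 0)]. *)
Lemma isolated_halves : isolated (p / 2) (q / 2) halves [].
Proof.
  pose proof perfect_parity as [Hp2 Hq2].
  intros [u v] Hc; cbn [fst snd]. apply in_halves in Hc.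
  pose proof (perfect_in _ _ Hc). split; [lia|]; split; [lia|].
  intros [u' v'] Had Hin. rewrite app_nil_r in Hin. apply in_halves in Hin.
  pose proof (perfect_in _ _ Hin).
  unfold adj in Had; cbn [fst snd] in Had.
  set (m := (u + u', v + v')).
  assert (Hm : ~ In m H) by (intros Hi; apply perfect_even in Hi; lia).
  assert ((0, 0) = m) as E; [|unfold m in E; injection E; lia].
  apply (path_inv (board p q H) (fun c => c = m) m); auto.
  - intros c [d1 d2] -> _ (_ & _ & Hd) Hmd; exfalso; apply Hd.
    unfold m, adj in Hmd; cbn [fst snd] in Hmd.
    assert (((d1 = 2 * u /\ d2 = 2 * v) \/ (d1 = 2 * u' /\ d2 = 2 * v')) \/
      (d1 mod 2 = 1 /\ d2 mod 2 = 1)) as [[[-> ->]|[-> ->]]|[Ho Ho']]; auto.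
    + assert ((u = u' /\ (v' = v + 1 \/ v = v' + 1)) \/ (v = v' /\ (u' = u + 1 \/ u = u' + 1)))
        as [[-> [-> | ->]]|[-> [-> | ->]]] by lia; lia.
    + apply perfect_odd_odd; auto; lia.
  - apply Hcon.
    + unfold m; repeat split; cbn [fst snd]; try lia. auto.
    + repeat split; cbn; try lia. intros Hi; apply perfect_in in Hi; lia.
Qed.

(** Odd-odd cells being holes, a tile path alternates between even-even tiles and tiles of odd
    colour. Dropping the latter and halving gives a path in the half box. *)
Lemma connected_halves : connected (board (p / 2) (q / 2) halves).
Proof.
  pose proof perfect_parity as [Hp2 Hq2].
  (* In the induction [a'] is the last even-even tile visited; the path is currently at it or next
     to it. *)
  assert (Hpath : forall a b, path_in (board p q H) a b ->
    even_cell b = true -> forall a', board p q H a' -> even_cell a' = true -> a' = a \/ adj a a' ->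
    path_in (board (p / 2) (q / 2) halves) (half a') (half b)).
  { assert (Hb : forall c, board p q H c -> even_cell c = true ->
      board (p / 2) (q / 2) halves (half c)).
    { intros [x y] (Hx & Hy & Hn) Hev. unfold even_cell, half in *; cbn [fst snd] in *.
      apply andb_prop in Hev as [E1 E2].
      repeat split; cbn [fst snd]; try lia. rewrite in_halves.
      replace (2 * (x / 2)) with x by lia. replace (2 * (y / 2)) with y by lia. auto. }
    assert (Hev : forall c, even_cell c = true <-> fst c mod 2 = 0 /\ snd c mod 2 = 0).
    { intros c; unfold even_cell; rewrite Bool.andb_true_iff, !Z.eqb_eq; tauto. }
    induction 1 as [c Hc|c d e Hc Hcd Hde IH]; intros He a' Ha' Hea' Hor.
    - assert (a' = c) as ->.
      { destruct Hor as [|Hor]; auto. apply Hev in He, Hea'. unfold adj in Hor. lia. }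
      constructor; auto.
    - apply Hev in Hea' as Hea.
      pose proof (path_start _ _ _ Hde) as Hd.
      destruct (even_cell c) eqn:Ec.
      + apply IH; auto. right. apply Hev in Ec.
        destruct Hor as [->|Hor]; [now apply adj_sym|]. unfold adj in Hor; lia.
      + assert (Hn : ~ (fst c mod 2 = 0 /\ snd c mod 2 = 0)) by (rewrite <- Hev, Ec; discriminate).
        destruct Hor as [->|Hor]; [contradiction|].
        destruct (even_cell d) eqn:Ed.
        * apply path_trans with (half d); [|apply IH; auto].
          apply Hev in Ed as Hed.
          assert (a' = d \/ adj (half a') (half d)) as [->|Hadj].
          { destruct (cell_eq a' d) as [|Hne]; auto. right.
            destruct a' as [a1 a2], d as [d1 d2], c as [c1 c2].
            unfold adj, half in *; cbn [fst snd] in *.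
            assert (Hne' : a1 <> d1 \/ a2 <> d2)
              by (destruct (Z.eq_dec a1 d1); [right|left]; congruence).
            clear - Hor Hcd Hed Hea Hne'. lia. }
          -- constructor; auto.
          -- apply path_one; auto.
        * exfalso.
          assert (Hn' : ~ (fst d mod 2 = 0 /\ snd d mod 2 = 0)) by (rewrite <- Hev, Ed; discriminate).
          destruct d as [d1 d2]. destruct Hd as (Hd1 & Hd2 & Hd3). apply Hd3.
          unfold adj in *; cbn [fst snd] in *.
          apply perfect_odd_odd; auto; lia. }
  intros [x y] [x' y'] (Hx & Hy & Hn) (Hx' & Hy' & Hn'); cbn [fst snd] in *.
  rewrite in_halves in Hn, Hn'.
  assert (Hh : forall u v, half (2 * u, 2 * v) = (u, v)) by (intros; unfold half; cbn [fst snd]; f_equal; lia).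
  assert (Hev : forall u v, even_cell (2 * u, 2 * v) = true).
  { intros; unfold even_cell; cbn [fst snd]. apply andb_true_intro; split; lia. }
  rewrite <- (Hh x y), <- (Hh x' y').
  assert (Hb : board p q H (2 * x, 2 * y)) by (repeat split; cbn [fst snd]; auto; lia).
  assert (Hb' : board p q H (2 * x', 2 * y')) by (repeat split; cbn [fst snd]; auto; lia).
  apply (Hpath (2 * x, 2 * y)); auto.
Qed.

End Perfect.

Lemma perfect_power n : forall p q H,
  1 <= p -> 1 <= q -> p <= Z.of_nat n -> NoDup H -> isolated p q H [] -> connected (board p q H) ->
  p * q = 3 * Z.of_nat (length H) + 1 ->
  exists l : nat, p = 2 ^ Z.of_nat l /\ q = 2 ^ Z.of_nat l.
Proof.
  induction n as [|n IH]; intros p q H Hp Hq Hn Hnd Hiso Hcon Hpq; [lia|].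
  assert ((p = 1 \/ q = 1) \/ (2 <= p /\ 2 <= q)) as [H1|[Hp2 Hq2]] by lia.
  (* A side parameter equal to 1 leaves no room for a hole, so p*q = 1. *)
  - exists O. destruct H as [|c H].
    + cbn in Hpq. destruct H1; subst; cbn; lia.
    + destruct (Hiso c); [now left|]. lia.
  - destruct (perfect_parity p q H) as [Ep Eq]; auto.
    pose proof (length_halves p q H Hp2 Hq2 Hnd Hiso Hcon Hpq) as Hlen.
    destruct (IH (p / 2) (q / 2) (halves H)) as (l & El & El'); try lia.
    + now apply NoDup_halves.
    + now apply isolated_halves.
    + now apply connected_halves.
    + exists (S l). rewrite Nat2Z.inj_succ, Z.pow_succ_r by lia. lia.
Qed.

(** * Extending a box by strips of width three *)

(** The invariant preserved by adding strips. The bounds p - 2 and q - 2 keep the cut away from new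
    strips on the right or top and from the corners [(p, 0)] and [(0, q)]. *)
Record config (p q : Z) (H D : list cell) : Prop := {
  config_size : 3 <= p /\ 3 <= q;
  config_NoDup : NoDup H /\ NoDup D;
  config_isolated : isolated p q H D;
  config_cut : forall x y, In (x, y) D ->
    0 <= x <= p - 2 /\ 0 <= y <= q - 2 /\ (x = 0 \/ y = 0);
  config_connected : connected (board p q (H ++ D));
  (* a detour around the cut [D], away from the right and top sides *)
  config_detour : exists a b, 1 <= a <= q - 1 /\ 1 <= b <= p - 1 /\
    (forall y, a <= y -> ~ In (0, y) D) /\ (forall x, b <= x -> ~ In (x, 0) D) /\
    path_in (fun c => board p q (H ++ D) c /\ fst c < p /\ snd c < q) (0, a) (b, 0)
}.

Definition swap (c : cell) : cell := (snd c, fst c).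

Lemma in_swap l x y : In (x, y) (map swap l) <-> In (y, x) l.
Proof.
  rewrite in_map_iff; split.
  - intros ([a b] & E & Hi). injection E as -> ->; auto.
  - intros Hi; exists (y, x); auto.
Qed.

Lemma NoDup_swap l : NoDup l -> NoDup (map swap l).
Proof. apply NoDup_map_inj. intros [a b] [a' b'] _ _ E; injection E as -> ->; auto. Qed.

Lemma adj_swap a b : adj a b -> adj (swap a) (swap b).
Proof. unfold adj, swap; cbn [fst snd]; lia. Qed.

Lemma path_swap (S S' : cell -> Prop) a b :
  (forall x y, S (x, y) -> S' (y, x)) -> path_in S a b -> path_in S' (swap a) (swap b).
Proof.
  intros HS; assert (HS' : forall c, S c -> S' (swap c)) by (intros [x y]; apply HS).
  induction 1; [constructor; auto|econstructor; eauto using adj_swap].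
Qed.

Lemma board_swap p q H D x y :
  board p q (H ++ D) (x, y) -> board q p (map swap H ++ map swap D) (y, x).
Proof.
  unfold board; cbn [fst snd]; rewrite !in_app_iff, !in_swap; tauto.
Qed.

Lemma isolated_swap p q H D : isolated p q H D -> isolated q p (map swap H) (map swap D).
Proof.
  intros Hiso [x y] Hin; cbn [fst snd].
  rewrite in_swap in Hin; apply Hiso in Hin as (H1 & H2 & H3); cbn [fst snd] in *.
  split; [auto|]; split; [auto|]. intros [u v] Had. rewrite in_app_iff, !in_swap, <- in_app_iff.
  apply H3. apply adj_swap in Had; auto.
Qed.

Lemma connected_swap p q H D :
  connected (board p q (H ++ D)) -> connected (board q p (map swap H ++ map swap D)).
Proof.
  intros Hc [x y] [x' y'] Ha Hb.
  change (x, y) with (swap (y, x)). change (x', y') with (swap (y', x')).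
  apply path_swap with (board p q (H ++ D)).
  - apply board_swap.
  - assert (forall u v, board q p (map swap H ++ map swap D) (u, v) -> board p q (H ++ D) (v, u)).
    { intros u v; unfold board; cbn [fst snd]; rewrite !in_app_iff, !in_swap; tauto. }
    apply Hc; auto.
Qed.

Lemma config_swap p q H D : config p q H D -> config q p (map swap H) (map swap D).
Proof.
  intros [Hs [HN HN'] Hiso Hcut Hcon (a & b & Ha & Hb & Ha' & Hb' & Hp)]; split.
  - tauto.
  - split; now apply NoDup_swap.
  - now apply isolated_swap.
  - intros x y Hin; rewrite in_swap in Hin; apply Hcut in Hin; tauto.
  - now apply connected_swap.
  - exists b, a; split; [auto|]; split; [auto|]; split; [|split].
    + intros y Hy; rewrite in_swap; auto.
    + intros x Hx; rewrite in_swap; auto.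
    + apply path_sym.
      change (a, 0) with (swap (0, a)). change (0, b) with (swap (b, 0)).
      eapply path_swap; [|exact Hp].
      intros x y (Hbd & Hx & Hy); cbn [fst snd] in *; split; [now apply board_swap|auto].
Qed.

Lemma config_inner p q H D x y : config p q H D -> In (x, y) H -> 1 <= x <= p - 1 /\ 1 <= y <= q - 1.
Proof. intros Hc Hin; apply (config_isolated _ _ _ _ Hc) in Hin; cbn in Hin; lia. Qed.

(* [b] tells whether the strip is attached at the bottom or at the top right
   corner; [mirror b q] turns one case into the other. *)
Definition mirror (b : bool) (q y : Z) : Z := if b then y else q - y.

(** A diagonal chain: one hole in each of q - 1 rows, alternating between the columns p + 2 and p +
    1, and one more in the old side column p. These q holes balance the 3*q new interior
    vertices. *)
Definition strip (b : bool) (p q : Z) : list cell :=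
  (p, mirror b q 1) ::
  map (fun y => (p + 1 + y mod 2, mirror b q y)) (zrange 1 (Z.to_nat (q - 1))).

Lemma in_strip b p q x y :
  In (x, y) (strip b p q) <->
  (x = p /\ y = mirror b q 1) \/
  (1 <= mirror b q y <= q - 1 /\ x = p + 1 + mirror b q y mod 2).
Proof.
  unfold strip; cbn [In]; rewrite in_map_iff. split.
  - intros [E|(z & E & Hz)].
    + injection E as <- <-; auto.
    + apply in_zrange in Hz. apply pair_equal_spec in E as [<- <-]. right.
      unfold mirror; destruct b; [lia|]. replace (q - (q - z)) with z by lia. lia.
  - intros [[-> ->]|[Hy ->]]; auto. right.
    exists (mirror b q y); split; [|apply in_zrange; lia].
    f_equal. unfold mirror; destruct b; lia.
Qed.

Lemma NoDup_strip b p q : NoDup (strip b p q).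
Proof.
  unfold strip; constructor.
  - rewrite in_map_iff; intros (y & E & _). apply pair_equal_spec in E as [E _]. lia.
  - apply NoDup_map_inj; [|apply NoDup_zrange].
    intros y y' _ _ E. apply pair_equal_spec in E as [_ E]. unfold mirror in E; destruct b; lia.
Qed.

Lemma length_strip b p q : 1 <= q -> Z.of_nat (length (strip b p q)) = q.
Proof. intros; unfold strip; cbn [length]; rewrite length_map, length_zrange; lia. Qed.

Lemma connected_hub (S : cell -> Prop) h : (forall c, S c -> path_in S c h) -> connected S.
Proof. intros Hh a b Ha Hb; apply path_trans with h; auto using path_sym. Qed.

(** The old box loses only the tile [w] of its right column. Paths through [w] are rerouted along
    the row [e0] or around the far end of the strip; [Hcorner] keeps the new hole [w] apart from the
    old ones. *)
Lemma config_strip b p q H D :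
  config p q H D -> q mod 2 = 1 -> ~ In (p - 1, mirror b q 1) H ->
  config (p + 3) q (H ++ strip b p q) D.
Proof.
  intros Hcfg Hodd Hcorner.
  pose proof (fun x y => config_inner p q H D x y Hcfg) as HinH.
  destruct Hcfg as [[Hp Hq] [HN HN'] Hiso Hcut Hcon (a & b' & Ha & Hb & Ha' & Hb' & Hpath)].
  set (T := board p q (H ++ D)) in *.
  set (T' := board (p + 3) q ((H ++ strip b p q) ++ D)).
  assert (HT : forall x y, T (x, y) <-> 0 <= x <= p /\ 0 <= y <= q /\ ~ In (x, y) H /\ ~ In (x, y) D).
  { intros x y; unfold T, board; cbn [fst snd]; rewrite in_app_iff; tauto. }
  assert (HT' : forall x y, T' (x, y) <-> 0 <= x <= p + 3 /\ 0 <= y <= q /\ ~ In (x, y) H /\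
      ~ In (x, y) D /\ ~ (x = p /\ y = mirror b q 1) /\
      ~ (1 <= mirror b q y <= q - 1 /\ x = p + 1 + mirror b q y mod 2)).
  { intros x y; unfold T', board; cbn [fst snd]; rewrite !in_app_iff, in_strip; tauto. }
  assert (ET' : forall c, T' c <-> board (p + 3) q ((H ++ strip b p q) ++ D) c) by (intros; reflexivity).
  clearbody T T'.
  assert (Hnew : forall x y, p <= x <= p + 3 -> 0 <= y <= q -> ~ (x = p /\ y = mirror b q 1) ->
      ~ (1 <= mirror b q y <= q - 1 /\ x = p + 1 + mirror b q y mod 2) -> T' (x, y)).
  { intros x y Hx Hy H1 H2; apply HT'. repeat split; try lia; auto.
    - intros Hi; apply HinH in Hi; lia.
    - intros Hi; apply Hcut in Hi; lia. }
  assert (Hold : forall x y, T (x, y) -> ~ (x = p /\ y = mirror b q 1) -> T' (x, y)).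
  { intros x y Hxy H1. apply HT in Hxy as (? & ? & ? & ?). apply HT'. repeat split; try lia; auto. }
  set (e0 := mirror b q 0). set (e1 := mirror b q q).
  set (w := (p, mirror b q 1)).
  assert (Hm : e0 = 0 /\ e1 = q /\ mirror b q 1 = 1 \/ e0 = q /\ e1 = 0 /\ mirror b q 1 = q - 1).
  { unfold e0, e1, mirror; destruct b; lia. }
  assert (Hmir : forall y, mirror b q y = y /\ e0 = 0 /\ e1 = q /\ mirror b q 1 = 1 \/
                   mirror b q y = q - y /\ e0 = q /\ e1 = 0 /\ mirror b q 1 = q - 1).
  { intros y; unfold e0, e1, mirror; destruct b; lia. }
  assert (Hloop1 : path_in T' (p, e0) (p + 3, e0)).
  { apply hline; intros x Hx; apply Hnew; destruct (Hmir e0); lia. }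
  assert (Hright : forall y, 0 <= y <= q -> path_in T' (p + 3, e0) (p + 3, y)).
  { intros z Hz; apply vline; intros y Hy; apply Hnew; destruct (Hmir y); lia. }
  assert (Hloop2 : path_in T' (p + 3, e1) (p, e1)).
  { apply hline; intros x Hx; apply Hnew; destruct (Hmir e1); lia. }
  assert (Hhub : forall c, T' c -> path_in T' c (p, e0)).
  { intros [x y] Hc.
    assert (Holdhub : forall x y, T (x, y) -> ~ (x = p /\ y = mirror b q 1) ->
      path_in T' (x, y) (p, e0)).
    { clear x y Hc.
      set (f := fun c => if cell_eq c w then (p, e0) else c).
      assert (Hf : forall x y, ~ (x = p /\ y = mirror b q 1) -> f (x, y) = (x, y)).
      { intros x y Hn; unfold f. destruct (cell_eq (x, y) w) as [E|]; auto.
        unfold w in E; apply pair_equal_spec in E; tauto. }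
      assert (Hfw : f w = (p, e0)) by (unfold f; destruct (cell_eq w w); congruence).
      assert (Te0 : T (p, e0)).
      { apply HT; repeat split; try lia; [intros Hi; apply HinH in Hi; lia
          | intros Hi; apply Hcut in Hi; lia]. }
      assert (Hstep : forall c, T c -> adj w c -> path_in T' (p, e0) c).
      { intros [u v] Hc Had. unfold w, adj in Had; cbn [fst snd] in Had.
        pose proof (proj1 (HT u v) Hc) as (Hu & Hv & HH & HD).
        assert (u = p - 1 /\ v = mirror b q 1 \/ u = p /\ v = e0 \/
          u = p /\ (v = 2 \/ v = q - 2) /\ Z.abs (v - e1) = q - 2) as [[-> ->]|[[-> ->]|[-> [Hv2 Hv3]]]]
          by lia.
        - apply path_trans with (p - 1, e0).
          + apply path_one; [now apply Hold; try lia | | unfold adj; cbn [fst snd]; lia].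
            apply Hold; [|lia]. apply HT; repeat split; try lia;
              [intros Hi; apply HinH in Hi; lia | intros Hi; apply Hcut in Hi; lia].
          + apply path_one; [ | | unfold adj; cbn [fst snd]; lia].
            * apply Hold; [|lia]. apply HT; repeat split; try lia;
                [intros Hi; apply HinH in Hi; lia | intros Hi; apply Hcut in Hi; lia].
            * apply Hold; [auto|lia].
        - constructor. apply Hold; [auto|lia].
        (* The neighbour of [w] further along the old right column is reached by going all the way
           around the strip. *)
        - apply path_trans with (p + 3, e0); auto.
          apply path_trans with (p + 3, e1); [apply Hright; lia|].
          apply path_trans with (p, e1); auto.
          apply vline; intros y Hy; apply Hnew; try lia. }
      intros x y Hxy Hn.
      rewrite <- (Hf x y Hn). replace (p, e0) with (f (p, e0)) by (apply Hf; lia).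
      apply (connected_retract T T' f); auto.
      - intros [u v] Huv. destruct (cell_eq (u, v) w) as [->|Hne].
        + rewrite Hfw. apply Hold; [auto|lia].
        + assert (~ (u = p /\ v = mirror b q 1)) by (intros [-> ->]; now apply Hne).
          rewrite Hf; auto.
      - intros c d Hc Hd Hcd.
        destruct (cell_eq c w) as [->|Hcw], (cell_eq d w) as [->|Hdw].
        + unfold adj in Hcd; lia.
        + rewrite Hfw. replace (f d) with d by (unfold f; destruct (cell_eq d w); congruence). auto.
        + rewrite Hfw. replace (f c) with c by (unfold f; destruct (cell_eq c w); congruence).
          apply path_sym, Hstep; auto using adj_sym.
        + replace (f d) with d by (unfold f; destruct (cell_eq d w); congruence).
          replace (f c) with c by (unfold f; destruct (cell_eq c w); congruence).
          destruct c as [u v], d as [u' v'].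
          apply path_one; auto; apply Hold; auto; intros [-> ->]; auto. }
    pose proof (proj1 (HT' x y) Hc) as (Hx & Hy & HH & HD & H1 & H2).
    destruct (Z_le_gt_dec x p).
    { apply Holdhub; auto. apply HT; repeat split; try lia; auto. }
    assert (x = p + 1 \/ x = p + 2 \/ x = p + 3) as [-> |[-> | ->]] by lia.
    - destruct (Z.eq_dec y (mirror b q 1)) as [E|E].
      + assert (T' (p + 1, e0)) by (apply Hnew; try lia; destruct (Hmir e0); lia).
        apply path_trans with (p + 1, e0).
        * apply path_one; auto. unfold adj; cbn [fst snd]; lia.
        * apply path_one; auto; [apply Hnew; try lia; destruct (Hmir e0); lia|].
          unfold adj; cbn [fst snd]; lia.
      + apply path_trans with (p, y).
        * apply path_one; auto; [apply Hnew; try lia; destruct (Hmir y); lia|].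
          unfold adj; cbn [fst snd]; lia.
        * apply Holdhub; [|lia]. apply HT; repeat split; try lia;
            [intros Hi; apply HinH in Hi; lia | intros Hi; apply Hcut in Hi; lia].
    - apply path_trans with (p + 3, y).
      + apply path_one; auto; [apply Hnew; try lia; destruct (Hmir y); lia|].
        unfold adj; cbn [fst snd]; lia.
      + apply path_sym. apply path_trans with (p + 3, e0); auto.
    - apply path_sym. apply path_trans with (p + 3, e0); auto. }
  split.
  - lia.
  - split; auto. apply NoDup_app; auto using NoDup_strip.
    intros [x y] Hi Hi'. apply in_strip in Hi'. apply HinH in Hi.
    destruct (Hmir y); lia.
  - assert (Hnb : forall u v x y, In (u, v) H -> In (x, y) (strip b p q) -> adj (u, v) (x, y) -> False).
    { intros u v x y Hi Hi' Had. pose proof (HinH u v Hi). apply in_strip in Hi'.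
      unfold adj in Had; cbn [fst snd] in Had.
      destruct Hi' as [[-> ->]|[? ->]]; [|lia].
      apply Hcorner. replace (p - 1) with u by lia. replace (mirror b q 1) with v by lia. auto. }
    intros [x y] Hi; apply in_app_iff in Hi as [Hi|Hi]; cbn [fst snd].
    + pose proof (HinH x y Hi). split; [lia|]; split; [lia|].
      intros [u v] Had; rewrite !in_app_iff.
      destruct (Hiso _ Hi) as (_ & _ & Hn). specialize (Hn (u, v) Had). rewrite in_app_iff in Hn.
      intros [[Hi'|Hi']|Hi']; [tauto | | tauto]. eapply Hnb; eauto.
    + pose proof (proj1 (in_strip b p q x y) Hi) as Hi'.
      split; [destruct Hi'; lia|]. split; [destruct Hi', (Hmir y); lia|].
      intros [u v] Had; rewrite !in_app_iff. intros [[Hj|Hj]|Hj].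
      * eapply Hnb; eauto using adj_sym.
      * apply in_strip in Hj. unfold adj in Had; cbn [fst snd] in Had.
        destruct (Hmir y), (Hmir v); lia.
      * apply Hcut in Hj. unfold adj in Had; cbn [fst snd] in Had. lia.
  - intros x y Hi; apply Hcut in Hi; lia.
  - intros c d Hc Hd. apply path_mono with T'; [apply ET'|].
    apply (connected_hub T' (p, e0)); auto; now apply ET'.
  - exists a, b'; split; [lia|]; split; [lia|]; split; [auto|]; split; [auto|].
    eapply path_mono; [|exact Hpath].
    intros [x y] (H1 & H2 & H3); cbn [fst snd] in *.
    split; [apply ET', Hold; auto; lia|lia].
Qed.

(** * Deleting corners *)

Lemma connected_ext (S S' : cell -> Prop) :
  (forall c, S c <-> S' c) -> connected S -> connected S'.
Proof.
  intros HS Hc a b Ha Hb. apply path_mono with S; [apply HS|]. apply Hc; now apply HS.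
Qed.

Lemma connected_remove (S : cell -> Prop) g n :
  connected S -> S n -> n <> g ->
  (forall x, S x -> adj g x -> path_in (fun c => S c /\ c <> g) x n) ->
  connected (fun c => S c /\ c <> g).
Proof.
  intros HS Hn Hng Hadj.
  set (f := fun c => if cell_eq c g then n else c).
  assert (Hf : forall c, c <> g -> f c = c) by (intros c Hc; unfold f; destruct (cell_eq c g); congruence).
  assert (Hg : f g = n) by (unfold f; destruct (cell_eq g g); congruence).
  intros a b [Ha Hag] [Hb Hbg].
  rewrite <- (Hf a Hag), <- (Hf b Hbg).
  apply (connected_retract S); auto.
  - intros c Hc. destruct (cell_eq c g) as [->|Hne]; [now rewrite Hg|]. rewrite Hf; auto.
  - intros c d Hc Hd Hcd.
    destruct (cell_eq c g) as [->|Hcg], (cell_eq d g) as [->|Hdg].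
    + unfold adj in Hcd; lia.
    + rewrite Hg, Hf; auto. now apply path_sym, Hadj.
    + rewrite Hg, Hf; auto using adj_sym.
    + rewrite !Hf; auto. apply path_one; auto.
Qed.

Lemma connected_remove_local (S : cell -> Prop) g m :
  connected S -> S m -> m <> g -> (forall x, S x -> adj g x -> adj x m) ->
  connected (fun c => S c /\ c <> g).
Proof.
  intros HS Hm Hmg Hadj. apply connected_remove with m; auto.
  intros x Hx Hgx. apply path_one; auto. split; auto.
  intros ->; unfold adj in Hgx; lia.
Qed.

(** The sides of the box, with the detour in place of the cut, form a closed route through the three
    corners. Without [g], its two neighbours stay joined by the rest of that route. *)
Lemma config_remove_corner p q H D g :
  config p q H D -> g = (p, q) \/ g = (p, 0) \/ g = (0, q) ->
  connected (fun c => board p q (H ++ D) c /\ c <> g).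
Proof.
  intros Hcfg Hg.
  pose proof (fun x y => config_inner p q H D x y Hcfg) as HinH.
  destruct Hcfg as [[Hp Hq] _ _ Hcut Hcon (a & b & Ha & Hb & Ha' & Hb' & Hpath)].
  assert (HS : forall x y, 0 <= x <= p -> 0 <= y <= q -> x = 0 \/ x = p \/ y = 0 \/ y = q ->
    ~ In (x, y) D -> (x, y) <> g -> board p q (H ++ D) (x, y) /\ (x, y) <> g).
  { intros x y Hx Hy Hside HD Hne; split; auto. repeat split; cbn [fst snd]; try lia.
    rewrite in_app_iff; intros [Hi|Hi]; auto. apply HinH in Hi; lia. }
  assert (Hneq : forall x y u v : Z, g = (u, v) -> x <> u \/ y <> v -> (x, y) <> g).
  { intros x y u v -> Hne E; apply pair_equal_spec in E; lia. }
  assert (Htop : forall x x' , (forall z, x <= z <= x' \/ x' <= z <= x -> 0 <= z <= p /\ (z, q) <> g) ->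
     path_in (fun c => board p q (H ++ D) c /\ c <> g) (x, q) (x', q)).
  { intros x x' Hz; apply hline; intros z Hzz; apply Hz in Hzz as [? ?]; apply HS; try lia; auto.
    intros Hi; apply Hcut in Hi; lia. }
  assert (Hright : forall y y', (forall z, y <= z <= y' \/ y' <= z <= y -> 0 <= z <= q /\ (p, z) <> g) ->
     path_in (fun c => board p q (H ++ D) c /\ c <> g) (p, y) (p, y')).
  { intros x x' Hz; apply vline; intros z Hzz; apply Hz in Hzz as [? ?]; apply HS; try lia; auto.
    intros Hi; apply Hcut in Hi; lia. }
  assert (Hbot : forall x x', (forall z, x <= z <= x' \/ x' <= z <= x -> b <= z <= p /\ (z, 0) <> g) ->
     path_in (fun c => board p q (H ++ D) c /\ c <> g) (x, 0) (x', 0)).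
  { intros x x' Hz; apply hline; intros z Hzz; apply Hz in Hzz as [? ?]; apply HS; try lia; auto.
    apply Hb'; lia. }
  assert (Hleft : forall y y', (forall z, y <= z <= y' \/ y' <= z <= y -> a <= z <= q /\ (0, z) <> g) ->
     path_in (fun c => board p q (H ++ D) c /\ c <> g) (0, y) (0, y')).
  { intros x x' Hz; apply vline; intros z Hzz; apply Hz in Hzz as [? ?]; apply HS; try lia; auto.
    apply Ha'; lia. }
  assert (Hdet : path_in (fun c => board p q (H ++ D) c /\ c <> g) (0, a) (b, 0)).
  { eapply path_mono; [|exact Hpath]. intros c (H1 & H2 & H3); split; auto.
    intros ->; destruct Hg as [-> | [-> | ->]]; cbn [fst snd] in *; lia. }
  destruct Hg as [Hg|[Hg|Hg]].
  - assert (path_in (fun c => board p q (H ++ D) c /\ c <> g) (p - 1, q) (p, q - 1)).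
    { apply path_trans with (0, q); [apply Htop; intros; split; [lia|]; eapply Hneq; eauto; lia|].
      apply path_trans with (0, a); [apply Hleft; intros; split; [lia|]; eapply Hneq; eauto; lia|].
      apply path_trans with (b, 0); auto.
      apply path_trans with (p, 0); [apply Hbot; intros; split; [lia|]; eapply Hneq; eauto; lia|].
      apply Hright; intros; split; [lia|]; eapply Hneq; eauto; lia. }
    apply connected_remove with (p, q - 1); auto.
    + now apply path_end in H0.
    + eapply Hneq; eauto; lia.
    + intros [x y] (Hx & Hy & _) Hgx; subst g; unfold adj in Hgx; cbn [fst snd] in *.
      assert (x = p - 1 /\ y = q \/ x = p /\ y = q - 1) as [[-> ->]|[-> ->]] by lia; auto.
      constructor. now apply path_end in H0.
  - assert (path_in (fun c => board p q (H ++ D) c /\ c <> g) (p - 1, 0) (p, 1)).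
    { apply path_trans with (b, 0); [apply Hbot; intros; split; [lia|]; eapply Hneq; eauto; lia|].
      apply path_trans with (0, a); [now apply path_sym|].
      apply path_trans with (0, q); [apply Hleft; intros; split; [lia|]; eapply Hneq; eauto; lia|].
      apply path_trans with (p, q); [apply Htop; intros; split; [lia|]; eapply Hneq; eauto; lia|].
      apply Hright; intros; split; [lia|]; eapply Hneq; eauto; lia. }
    apply connected_remove with (p, 1); auto.
    + now apply path_end in H0.
    + eapply Hneq; eauto; lia.
    + intros [x y] (Hx & Hy & _) Hgx; subst g; unfold adj in Hgx; cbn [fst snd] in *.
      assert (x = p - 1 /\ y = 0 \/ x = p /\ y = 1) as [[-> ->]|[-> ->]] by lia; auto.
      constructor. now apply path_end in H0.
  - assert (path_in (fun c => board p q (H ++ D) c /\ c <> g) (1, q) (0, q - 1)).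
    { apply path_trans with (p, q); [apply Htop; intros; split; [lia|]; eapply Hneq; eauto; lia|].
      apply path_trans with (p, 0); [apply Hright; intros; split; [lia|]; eapply Hneq; eauto; lia|].
      apply path_trans with (b, 0); [apply Hbot; intros; split; [lia|]; eapply Hneq; eauto; lia|].
      apply path_trans with (0, a); [now apply path_sym|].
      apply Hleft; intros; split; [lia|]; eapply Hneq; eauto; lia. }
    apply connected_remove with (0, q - 1); auto.
    + now apply path_end in H0.
    + eapply Hneq; eauto; lia.
    + intros [x y] (Hx & Hy & _) Hgx; subst g; unfold adj in Hgx; cbn [fst snd] in *.
      assert (x = 1 /\ y = q \/ x = 0 /\ y = q - 1) as [[-> ->]|[-> ->]] by lia; auto.
      constructor. now apply path_end in H0.
Qed.

(* [K] is the set of deleted boundary cells. For [C = 5] three of them are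
   consecutive; otherwise they are pairwise non-adjacent, as doubling requires. *)
Definition realizable (p q C : Z) : Prop :=
  exists H K, NoDup H /\ NoDup K /\ Z.of_nat (length K) = C /\
    3 * Z.of_nat (length H) + C = p * q /\ isolated p q H K /\
    (forall c, In c K -> 0 <= fst c <= p /\ 0 <= snd c <= q /\
       (fst c = 0 \/ fst c = p \/ snd c = 0 \/ snd c = q)) /\
    connected (board p q (H ++ K)) /\
    (C <= 4 -> forall c d, In c K -> In d K -> ~ adj c d).

Lemma realizable_swap p q C : realizable p q C -> realizable q p C.
Proof.
  intros (H & K & HN & HN' & Hl & Hn & Hiso & HK & Hc & Hsep).
  exists (map swap H), (map swap K).
  split; [now apply NoDup_swap|]; split; [now apply NoDup_swap|].
  rewrite !length_map. split; [auto|]; split; [lia|].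
  split; [now apply isolated_swap|]; split; [|split; [now apply connected_swap|]].
  - intros [x y] Hi; rewrite in_swap in Hi. apply HK in Hi; cbn [fst snd] in *. lia.
  - intros HC [x y] [u v] Hi Hi'. rewrite in_swap in Hi, Hi'. intros Had.
    apply (Hsep HC _ _ Hi Hi'). now apply adj_swap in Had.
Qed.

(** The last hypothesis provides the separation clause: a cut with several cells is allowed only
    when at least five cells are deleted in all. *)
Lemma config_realizable p q H D C :
  config p q H D -> NoDup C ->
  (forall c, In c C -> c = (p, q) \/ c = (p, 0) \/ c = (0, q)) ->
  connected (board p q (H ++ C ++ D)) ->
  3 * Z.of_nat (length H) + Z.of_nat (length C + length D) = p * q ->
  (length D <= 1 \/ 5 <= length C + length D)%nat ->
  realizable p q (Z.of_nat (length C + length D)).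
Proof.
  intros Hcfg HC HCc Hcon Hn Hlen.
  pose proof (fun x y => config_inner p q H D x y Hcfg) as HinH.
  destruct Hcfg as [[Hp Hq] [HN HN'] Hiso Hcut _ _].
  exists H, (C ++ D).
  split; [auto|]; split; [|split; [now rewrite length_app|split; [auto|split; [|split; [|split; [auto|]]]]]].
  - apply NoDup_app; auto. intros [x y] Hi Hi'. apply Hcut in Hi'.
    apply HCc in Hi as [E|[E|E]]; apply pair_equal_spec in E; lia.
  - intros [x y] Hi. destruct (Hiso _ Hi) as (H1 & H2 & H3). split; [auto|]; split; [auto|].
    intros [u v] Had. specialize (H3 _ Had). rewrite in_app_iff in H3. rewrite !in_app_iff.
    intros [Hj|[Hj|Hj]]; [tauto| |tauto].
    unfold adj in Had; cbn [fst snd] in *.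
    apply HCc in Hj as [E|[E|E]]; apply pair_equal_spec in E; lia.
  - intros [x y] Hi; cbn [fst snd]. apply in_app_iff in Hi as [Hi|Hi].
    + apply HCc in Hi as [E|[E|E]]; apply pair_equal_spec in E; lia.
    + apply Hcut in Hi; lia.
  - intros H4 [x y] [u v] Hi Hj Had. unfold adj in Had; cbn [fst snd] in Had.
    apply in_app_iff in Hi as [Hi|Hi], Hj as [Hj|Hj].
    + apply HCc in Hi as [E|[E|E]], Hj as [E'|[E'|E']];
        apply pair_equal_spec in E, E'; lia.
    + apply Hcut in Hj. apply HCc in Hi as [E|[E|E]]; apply pair_equal_spec in E; lia.
    + apply Hcut in Hi. apply HCc in Hj as [E|[E|E]]; apply pair_equal_spec in E; lia.
    + assert (length D <= 1)%nat as HD by lia.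
      destruct D as [|d [|d' D]]; cbn in HD; try lia; [destruct Hi|].
      destruct Hi as [->|[]], Hj as [E|[]]. apply pair_equal_spec in E; lia.
Qed.

(* Two of the three corners are cut off behind inner tiles, the remaining one
   is bypassed along the rest of the boundary. *)
Lemma realizable_three p q H D :
  config p q H D -> ~ In (1, q - 1) H -> ~ In (p - 1, 1) H \/ ~ In (p - 1, q - 1) H ->
  3 * Z.of_nat (length H) + Z.of_nat (length D) + 3 = p * q -> (length D <= 1)%nat ->
  realizable p q (Z.of_nat (length D) + 3).
Proof.
  intros Hcfg HTL Hor Hn HD.
  pose proof (fun x y => config_inner p q H D x y Hcfg) as HinH.
  pose proof Hcfg as [[Hp Hq] _ _ Hcut _ _].
  set (C := [(0, q); (p, 0); (p, q)]).
  assert (HC : NoDup C).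
  { unfold C; repeat constructor; cbn [In]; rewrite ?pair_equal_spec; lia. }
  replace (Z.of_nat (length D) + 3) with (Z.of_nat (length C + length D)) by (cbn [length C]; lia).
  apply config_realizable with H; auto.
  3: cbn [length C]; lia.
  1: unfold C; cbn [In]; intros c; intuition auto.
  assert (Hin : forall x y, 0 < x < p -> 0 < y < q -> ~ In (x, y) H -> board p q (H ++ D) (x, y)).
  { intros x y Hx Hy HH; repeat split; cbn [fst snd]; try lia.
    rewrite in_app_iff; intros [Hi|Hi]; auto. apply Hcut in Hi; lia. }
  assert (Hneq : forall x y u v : Z, x <> u \/ y <> v -> (x, y) <> (u, v)).
  { intros x y u v Hne E; apply pair_equal_spec in E; lia. }
  destruct Hor as [HBR|HTR].
  - apply (connected_ext (fun c => ((board p q (H ++ D) c /\ c <> (p, q)) /\ c <> (0, q)) /\ c <> (p, 0))).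
    { intros c; unfold board, C; rewrite !in_app_iff; cbn [In]. intuition congruence. }
    apply (connected_remove_local (fun c => (board p q (H ++ D) c /\ c <> (p, q)) /\ c <> (0, q))
             (p, 0) (p - 1, 1)).
    + apply (connected_remove_local (fun c => board p q (H ++ D) c /\ c <> (p, q)) (0, q) (1, q - 1)).
      * apply config_remove_corner; auto.
      * split; [apply Hin; auto; lia | apply Hneq; lia].
      * apply Hneq; lia.
      * intros [x y] [(Hx & Hy & _) _] Had; unfold adj in *; cbn [fst snd] in *; lia.
    + split; [split; [apply Hin; auto; lia | apply Hneq; lia] | apply Hneq; lia].
    + apply Hneq; lia.
    + intros [x y] [[(Hx & Hy & _) _] _] Had; unfold adj in *; cbn [fst snd] in *; lia.
  - apply (connected_ext (fun c => ((board p q (H ++ D) c /\ c <> (p, 0)) /\ c <> (0, q)) /\ c <> (p, q))).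
    { intros c; unfold board, C; rewrite !in_app_iff; cbn [In]. intuition congruence. }
    apply (connected_remove_local (fun c => (board p q (H ++ D) c /\ c <> (p, 0)) /\ c <> (0, q))
             (p, q) (p - 1, q - 1)).
    + apply (connected_remove_local (fun c => board p q (H ++ D) c /\ c <> (p, 0)) (0, q) (1, q - 1)).
      * apply config_remove_corner; auto.
      * split; [apply Hin; auto; lia | apply Hneq; lia].
      * apply Hneq; lia.
      * intros [x y] [(Hx & Hy & _) _] Had; unfold adj in *; cbn [fst snd] in *; lia.
    + split; [split; [apply Hin; auto; lia | apply Hneq; lia] | apply Hneq; lia].
    + apply Hneq; lia.
    + intros [x y] [[(Hx & Hy & _) _] _] Had; unfold adj in *; cbn [fst snd] in *; lia.
Qed.

(** The corner [(0, q)] is bypassed along the boundary and [(p, 0)] behind the inner tile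
    [(p - 1, 1)]; the cut supplies the other three deletions. *)
Lemma realizable_two p q H D :
  config p q H D -> ~ In (p - 1, 1) H ->
  3 * Z.of_nat (length H) + 5 = p * q -> length D = 3%nat ->
  realizable p q 5.
Proof.
  intros Hcfg HBR Hn HD.
  pose proof Hcfg as [[Hp Hq] _ _ Hcut _ _].
  set (C := [(0, q); (p, 0)]).
  assert (HC : NoDup C).
  { unfold C; repeat constructor; cbn [In]; rewrite ?pair_equal_spec; lia. }
  replace 5 with (Z.of_nat (length C + length D)) by (cbn [length C]; lia).
  apply config_realizable with H; auto.
  3,4: cbn [length C]; lia.
  1: unfold C; cbn [In]; intros c; intuition auto.
  assert (Hneq : forall x y u v : Z, x <> u \/ y <> v -> (x, y) <> (u, v)).
  { intros x y u v Hne E; apply pair_equal_spec in E; lia. }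
  apply (connected_ext (fun c => (board p q (H ++ D) c /\ c <> (0, q)) /\ c <> (p, 0))).
  { intros c; unfold board, C; rewrite !in_app_iff; cbn [In]. intuition congruence. }
  apply (connected_remove_local (fun c => board p q (H ++ D) c /\ c <> (0, q)) (p, 0) (p - 1, 1)).
  - apply config_remove_corner; auto.
  - split; [|apply Hneq; lia]. repeat split; cbn [fst snd]; try lia.
    rewrite in_app_iff; intros [Hi|Hi]; auto. apply Hcut in Hi; lia.
  - apply Hneq; lia.
  - intros [x y] [(Hx & Hy & _) _] Had; unfold adj in *; cbn [fst snd] in *; lia.
Qed.

(** * Doubling *)

Definition double (c : cell) : cell := (2 * fst c, 2 * snd c).

Lemma in_double l x y :
  In (x, y) (map double l) <-> x mod 2 = 0 /\ y mod 2 = 0 /\ In (x / 2, y / 2) l.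
Proof.
  rewrite in_map_iff; split.
  - intros ([a b] & E & Hi). apply pair_equal_spec in E as [<- <-]; cbn [fst snd].
    replace (2 * a / 2) with a by lia. replace (2 * b / 2) with b by lia.
    split; [lia|]; split; [lia|auto].
  - intros (Hx & Hy & Hi). exists (x / 2, y / 2); split; auto.
    unfold double; cbn [fst snd]; f_equal; lia.
Qed.

Lemma NoDup_double l : NoDup l -> NoDup (map double l).
Proof.
  apply NoDup_map_inj. intros [a b] [a' b'] _ _ E.
  apply pair_equal_spec in E; cbn [fst snd] in E. f_equal; lia.
Qed.

Definition odd_cells (p q : Z) : list cell :=
  map (fun c => (2 * fst c + 1, 2 * snd c + 1)) (zbox 0 0 (Z.to_nat p) (Z.to_nat q)).

Lemma in_odd_cells p q x y :
  In (x, y) (odd_cells p q) <->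
  x mod 2 = 1 /\ y mod 2 = 1 /\ 0 <= x < 2 * p /\ 0 <= y < 2 * q.
Proof.
  unfold odd_cells; rewrite in_map_iff; split.
  - intros ([a b] & E & Hi). apply in_zbox in Hi; cbn [fst snd] in *.
    apply pair_equal_spec in E as [<- <-]. lia.
  - intros Hxy. exists (x / 2, y / 2); cbn [fst snd]; split; [f_equal; lia|].
    apply in_zbox; cbn [fst snd]; lia.
Qed.

(** The reverse of halving: a tile of odd colour subdivides each old edge, and p*q odd-odd holes
    balance the growth from p*q to 4*p*q. A tile of odd colour lies between two even-even positions
    that were neighbours; one of them is a tile because no two removed cells are adjacent, which for
    [K] is the separation clause. *)
Lemma realizable_double p q C :
  1 <= p -> 1 <= q -> C <= 4 -> realizable p q C -> realizable (2 * p) (2 * q) C.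
Proof.
  intros Hp Hq HC4 (H & K & HN & HN' & Hl & Hn & Hiso & HK & Hc & Hsep).
  specialize (Hsep HC4).
  set (H' := odd_cells p q ++ map double H).
  assert (HinH : forall x y, In (x, y) H -> 1 <= x <= p - 1 /\ 1 <= y <= q - 1).
  { intros x y Hi; apply Hiso in Hi; cbn [fst snd] in Hi; lia. }
  assert (Hempty : forall c d, In c (H ++ K) -> In d (H ++ K) -> ~ adj c d).
  { intros c d Hi Hj Had. apply in_app_iff in Hi as [Hi|Hi].
    - destruct (Hiso c Hi) as (_ & _ & Hx). now apply (Hx d).
    - apply in_app_iff in Hj as [Hj|Hj].
      + destruct (Hiso d Hj) as (_ & _ & Hx). apply (Hx c); [now apply adj_sym|].
        apply in_app_iff; auto.
      + now apply (Hsep c d). }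
  assert (HE : forall x y, In (x, y) (H' ++ map double K) <->
    (x mod 2 = 1 /\ y mod 2 = 1 /\ 0 <= x < 2 * p /\ 0 <= y < 2 * q) \/
    (x mod 2 = 0 /\ y mod 2 = 0 /\ In (x / 2, y / 2) (H ++ K))).
  { intros x y; unfold H'; rewrite !in_app_iff, in_odd_cells, !in_double. tauto. }
  exists H', (map double K).
  split; [|split; [now apply NoDup_double|]]; rewrite ?length_map.
  { apply NoDup_app.
    - apply NoDup_map_inj; [|apply NoDup_zbox].
      intros [a b] [a' b'] _ _ E; cbn [fst snd] in E; apply pair_equal_spec in E; f_equal; lia.
    - now apply NoDup_double.
    - intros [x y] Hi Hj. apply in_odd_cells in Hi. apply in_double in Hj. lia. }
  split; [auto|]; split; [|split; [|split; [|split]]].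
  - unfold H', odd_cells; rewrite length_app, !length_map, length_zbox.
    rewrite Nat2Z.inj_add, Nat2Z.inj_mul, !Z2Nat.id by lia. lia.
  - intros [x y] Hi; cbn [fst snd].
    assert (Hxy : In (x, y) (H' ++ map double K)) by (apply in_app_iff; auto).
    assert (1 <= x <= 2 * p - 1 /\ 1 <= y <= 2 * q - 1) as [Hx Hy].
    { apply in_app_iff in Hi as [Hi|Hi]; [apply in_odd_cells in Hi; lia|].
      apply in_double in Hi as (? & ? & Hi). apply HinH in Hi; lia. }
    split; [auto|]; split; [auto|].
    intros [u v] Had. rewrite HE. rewrite HE in Hxy. unfold adj in Had; cbn [fst snd] in Had. lia.
  - intros [x y] Hi; cbn [fst snd]. apply in_double in Hi as (? & ? & Hi).
    apply HK in Hi; cbn [fst snd] in Hi. lia.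
  - set (T' := board (2 * p) (2 * q) (H' ++ map double K)).
    assert (HT' : forall x y, 0 <= x <= 2 * p -> 0 <= y <= 2 * q -> (x + y) mod 2 = 1 -> T' (x, y)).
    { intros x y Hx Hy Hxy. repeat split; cbn [fst snd]; try lia. rewrite HE; lia. }
    assert (Hev : forall c, board p q (H ++ K) c <-> T' (double c)).
    { intros [x y]. unfold T', board, double; cbn [fst snd]. rewrite HE.
      replace (2 * x / 2) with x by lia. replace (2 * y / 2) with y by lia.
      split; intros (H1 & H2 & H3).
      - split; [lia|]; split; [lia|]. intros [?|(_ & _ & ?)]; [lia|auto].
      - split; [lia|]; split; [lia|]. intros Hi; apply H3; right; repeat split; auto; lia. }
    assert (Hpath : forall a b, path_in (board p q (H ++ K)) a b -> path_in T' (double a) (double b)).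
    { induction 1 as [a Ha|a b c Ha Hab Hbc IH]; [constructor; now apply Hev|].
      apply path_trans with (double b); auto.
      pose proof (path_start _ _ _ Hbc) as Hb.
      apply Hev in Ha as Ha', Hb as Hb'.
      destruct a as [x y], b as [u v]. destruct Ha as (Hx & Hy & _), Hb as (Hu & Hv & _).
      unfold double, adj in *; cbn [fst snd] in *.
      assert (T' (x + u, y + v)) by (apply HT'; lia).
      apply path_trans with (x + u, y + v); apply path_one; auto; unfold adj; cbn [fst snd]; lia. }
    assert (Hreach : forall c, T' c -> exists a, board p q (H ++ K) a /\ path_in T' c (double a)).
    { intros [x y] Hc'. pose proof Hc' as (Hx & Hy & Hxy); cbn [fst snd] in *. rewrite HE in Hxy.
      assert (x mod 2 = 0 /\ y mod 2 = 0 \/ (x + y) mod 2 = 1) as [[E1 E2]|E] by lia.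
      - exists (x / 2, y / 2).
        assert (double (x / 2, y / 2) = (x, y)) as Ed by (unfold double; cbn [fst snd]; f_equal; lia).
        rewrite Hev, Ed; split; auto. now constructor.
      - assert (exists c d, adj c d /\ adj (x, y) (double c) /\ adj (x, y) (double d) /\
          0 <= fst c <= p /\ 0 <= snd c <= q /\ 0 <= fst d <= p /\ 0 <= snd d <= q)
          as (c & d & Hcd & Hxc & Hxd & Hr).
        { assert (x mod 2 = 1 /\ y mod 2 = 0 \/ x mod 2 = 0 /\ y mod 2 = 1) as [[E1 E2]|[E1 E2]] by lia.
          - exists (x / 2, y / 2), (x / 2 + 1, y / 2). unfold adj, double; cbn [fst snd]; lia.
          - exists (x / 2, y / 2), (x / 2, y / 2 + 1). unfold adj, double; cbn [fst snd]; lia. }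
        assert (board p q (H ++ K) c \/ board p q (H ++ K) d) as [Hb|Hb].
        { destruct (in_dec cell_eq c (H ++ K)) as [Hi|Hi].
          - right. repeat split; try lia. intros Hj. now apply (Hempty c d).
          - left. repeat split; try lia; auto. }
        + exists c; split; auto. apply path_one; auto. now apply Hev.
        + exists d; split; auto. apply path_one; auto. now apply Hev. }
    intros c d Hc' Hd'.
    destruct (Hreach c Hc') as (a & Ha & Pa), (Hreach d Hd') as (b & Hb & Pb).
    apply path_trans with (double a); auto. apply path_trans with (double b); auto using path_sym.
  - intros _ [x y] [u v] Hi Hj Had. apply in_double in Hi as (? & ? & _), Hj as (? & ? & _).
    unfold adj in Had; cbn [fst snd] in Had. lia.
Qed.

(** * Base boxes *)

Definition nbrs (c : cell) : list cell :=
  [(fst c + 1, snd c); (fst c - 1, snd c); (fst c, snd c + 1); (fst c, snd c - 1)].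

Lemma adj_nbrs c d : adj c d <-> In d (nbrs c).
Proof.
  destruct c as [x y], d as [u v]; unfold adj, nbrs; cbn [fst snd In].
  split.
  - intros H. assert (u = x + 1 /\ v = y \/ u = x - 1 /\ v = y \/ u = x /\ v = y + 1 \/
      u = x /\ v = y - 1) as [[-> ->]|[[-> ->]|[[-> ->]|[-> ->]]]] by lia; auto.
  - intros [E|[E|[E|[E|[]]]]]; apply pair_equal_spec in E; lia.
Qed.

Definition explore (l vis : list cell) : list cell :=
  fold_left (fun vis c => if negb (mem c vis) && existsb (fun d => mem d vis) (nbrs c)
                          then c :: vis else vis) l vis.

(** Sweeps in both list orders spread fast; five rounds suffice for the base boxes. A cell missed by
    the search could only make the check fail. *)
Definition reach (l : list cell) (a : cell) : list cell :=
  Nat.iter 5 (fun vis => explore (rev l) (explore l vis)) [a].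

Lemma explore_path l a l' vis c :
  incl l' l -> (forall c, In c vis -> path_in (fun d => In d l) a c) ->
  In c (explore l' vis) -> path_in (fun d => In d l) a c.
Proof.
  unfold explore. revert vis; induction l' as [|b l' IH]; cbn [fold_left]; intros vis Hl Hvis Hc; auto.
  apply IH in Hc; auto; [intros d Hd; apply Hl; now right|].
  destruct (negb (mem b vis) && existsb (fun d => mem d vis) (nbrs b)) eqn:E; auto.
  intros d [<-|Hd]; auto.
  apply andb_prop in E as [_ E]. apply existsb_exists in E as (d & Hd & E). apply memP in E.
  apply path_trans with d; auto. apply Hvis in E. apply path_one.
  - now apply path_end in E.
  - apply Hl; now left.
  - now apply adj_sym, adj_nbrs.
Qed.

Lemma reach_path l a c : In a l -> In c (reach l a) -> path_in (fun d => In d l) a c.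
Proof.
  intros Ha; unfold reach. generalize 5%nat as n; intros n; revert c.
  induction n as [|n IH]; cbn [Nat.iter nat_rect]; intros c Hc.
  - destruct Hc as [<-|[]]. now constructor.
  - revert Hc; apply explore_path; [intros d Hd; now apply in_rev|].
    intros d; apply explore_path; auto using incl_refl.
Qed.

(** The cuts of the base boxes lie on the bottom side to the left of [b]; the detour is searched
    from [(0, 1)] to [(b, 0)]. *)
Definition config_check (p q : Z) (H D : list cell) (b : Z) : bool :=
  let T := tiles p q (H ++ D) in
  (3 <=? p) && (3 <=? q) &&
  (length (nodup cell_eq H) =? length H)%nat && (length (nodup cell_eq D) =? length D)%nat &&
  forallb (fun c => (1 <=? fst c) && (fst c <=? p - 1) && (1 <=? snd c) && (snd c <=? q - 1) &&
    forallb (fun d => negb (mem d (H ++ D))) (nbrs c)) H &&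
  forallb (fun c => (0 <=? fst c) && (fst c <? b) && (snd c =? 0)) D && (b <=? p - 1) && (1 <=? b) &&
  forallb (fun c => mem c (reach T (0, 1))) T &&
  mem (b, 0) (reach (filter (fun c => (fst c <? p) && (snd c <? q)) T) (0, 1)).

Lemma nodup_length l : length (nodup cell_eq l) = length l -> NoDup l.
Proof.
  induction l as [|a l IH]; cbn; [constructor|].
  pose proof (NoDup_incl_length (NoDup_nodup cell_eq l) (fun x Hx => proj1 (nodup_In cell_eq l x) Hx)).
  destruct (in_dec cell_eq a l); cbn; intros E; [lia|].
  constructor; auto.
Qed.

Lemma config_checked p q H D b : config_check p q H D b = true -> config p q H D.
Proof.
  unfold config_check. rewrite !Bool.andb_true_iff, !forallb_forall, !Nat.eqb_eq, !memP.
  intros (((((((((Hp & Hq) & HN) & HN') & HH) & HD) & Hb) & Hb1) & Hr) & Hr').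
  apply Z.leb_le in Hp, Hq, Hb, Hb1.
  assert (HHx : forall c, In c H -> 1 <= fst c <= p - 1 /\ 1 <= snd c <= q - 1).
  { intros c Hc. specialize (HH c Hc). rewrite !Bool.andb_true_iff in HH. lia. }
  assert (HDx : forall c, In c D -> 0 <= fst c < b /\ snd c = 0).
  { intros c Hc. specialize (HD c Hc). rewrite !Bool.andb_true_iff in HD. lia. }
  assert (H01 : board p q (H ++ D) (0, 1)).
  { repeat split; cbn [fst snd]; try lia. rewrite in_app_iff; intros [Hi|Hi].
    - apply HHx in Hi; cbn [fst snd] in Hi; lia.
    - apply HDx in Hi; cbn [fst snd] in Hi; lia. }
  split; auto.
  - split; now apply nodup_length.
  - intros c Hc. pose proof (HHx c Hc). split; [lia|]; split; [lia|].
    intros d Hd. specialize (HH c Hc). rewrite !Bool.andb_true_iff, forallb_forall in HH.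
    destruct HH as [_ HH]. apply adj_nbrs in Hd. specialize (HH d Hd).
    now apply Bool.negb_true_iff, memPn in HH.
  - intros x y Hi. apply HDx in Hi; cbn [fst snd] in Hi; lia.
  - apply connected_ext with (fun c => In c (tiles p q (H ++ D))); [intros; apply in_tiles|].
    apply connected_hub with (0, 1). intros c Hc. apply path_sym, reach_path.
    + now apply in_tiles.
    + now apply memP, Hr.
  - exists 1, b. split; [lia|]; split; [lia|]; split; [|split].
    + intros y Hy Hi. apply HDx in Hi; cbn [fst snd] in Hi; lia.
    + intros x Hx Hi. apply HDx in Hi; cbn [fst snd] in Hi; lia.
    + apply reach_path in Hr'.
      * eapply path_mono; [|exact Hr']. intros c Hc. apply filter_In in Hc as [Hc Hlt].
        apply in_tiles in Hc. apply andb_prop in Hlt as [? ?]. split; [auto|lia].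
      * apply filter_In; split; [now apply in_tiles|]. cbn [fst snd].
        apply andb_true_intro; split; apply Z.ltb_lt; lia.
Qed.

(** * The families *)

(** [d] is the size of the cut and [e] the cyclomatic number. Inner tiles shield the corners
    [(0, q)] and [(p, 0)], which a swap of the axes exchanges, so growth in one direction yields
    growth in both. *)
Definition opposite_corners (d e p q : Z) : Prop :=
  exists H D, config p q H D /\ Z.of_nat (length D) = d /\ 3 * Z.of_nat (length H) + e = p * q /\
    ~ In (1, q - 1) H /\ ~ In (p - 1, 1) H.

Definition top_right_corner (d e p q : Z) : Prop :=
  exists H D, config p q H D /\ Z.of_nat (length D) = d /\ 3 * Z.of_nat (length H) + e = p * q /\
    ~ In (p - 1, q - 1) H.

Lemma opposite_corners_swap d e p q : opposite_corners d e p q -> opposite_corners d e q p.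
Proof.
  intros (H & D & Hc & Hd & He & H1 & H2).
  exists (map swap H), (map swap D). split; [now apply config_swap|].
  rewrite !length_map, !in_swap. repeat split; auto; lia.
Qed.

Lemma top_right_corner_swap d e p q : top_right_corner d e p q -> top_right_corner d e q p.
Proof.
  intros (H & D & Hc & Hd & He & H1).
  exists (map swap H), (map swap D). split; [now apply config_swap|].
  rewrite !length_map, !in_swap. repeat split; auto; lia.
Qed.

(** As q is odd, the zigzag ends in column p + 1 at its far end. The inner cell at the new corner
    there is free, so a mirrored strip can be attached. *)
Lemma strip_next_corner b p q H D :
  config p q H D -> q mod 2 = 1 -> ~ In (p + 3 - 1, mirror b q (q - 1)) (H ++ strip b p q).
Proof.
  intros Hc Hq Hi. apply in_app_iff in Hi as [Hi|Hi].
  - apply (config_inner _ _ _ _ _ _ Hc) in Hi; lia.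
  - apply in_strip in Hi. unfold mirror in Hi; destruct b; lia.
Qed.

Lemma strip_old_corner b p q H D x y :
  config p q H D -> x < p -> ~ In (x, y) H -> ~ In (x, y) (H ++ strip b p q).
Proof.
  intros Hc Hx HH Hi. apply in_app_iff in Hi as [Hi|Hi]; auto.
  apply in_strip in Hi. lia.
Qed.

Lemma length_app_strip b p q H :
  1 <= q -> Z.of_nat (length (H ++ strip b p q)) = Z.of_nat (length H) + q.
Proof. intros; rewrite length_app, Nat2Z.inj_add, length_strip; auto. Qed.

(** Two mirrored strips move the shielded right corner to the top and back. The parity of p is kept,
    so the other side can still be extended. *)
Lemma opposite_corners_6 d e p q :
  q mod 2 = 1 -> opposite_corners d e p q -> opposite_corners d e (p + 6) q.
Proof.
  intros Hq (H & D & Hc & Hd & He & H1 & H2).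
  pose proof (config_size _ _ _ _ Hc) as [Hp3 Hq3].
  pose proof (config_strip true p q H D Hc Hq H2) as Hc1.
  pose proof (strip_next_corner true p q H D Hc Hq) as Hn1; cbn [mirror] in Hn1.
  pose proof (config_strip false (p + 3) q _ D Hc1 Hq Hn1) as Hc2.
  pose proof (strip_next_corner false (p + 3) q _ D Hc1 Hq) as Hn2; cbn [mirror] in Hn2.
  replace (p + 3 + 3) with (p + 6) in * by lia.
  replace (q - (q - 1)) with 1 in Hn2 by lia.
  eexists _, D. split; [exact Hc2|]. split; [auto|]. split; [|split; [|exact Hn2]].
  - rewrite !length_app_strip by lia. lia.
  - eapply strip_old_corner; eauto; [lia|]. eapply strip_old_corner; eauto; lia.
Qed.

Lemma top_right_corner_6 d e p q :
  q mod 2 = 1 -> top_right_corner d e p q -> top_right_corner d e (p + 6) q.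
Proof.
  intros Hq (H & D & Hc & Hd & He & H1).
  pose proof (config_size _ _ _ _ Hc) as [Hp3 Hq3].
  pose proof (config_strip false p q H D Hc Hq H1) as Hc1.
  pose proof (strip_next_corner false p q H D Hc Hq) as Hn1; cbn [mirror] in Hn1.
  replace (q - (q - 1)) with 1 in Hn1 by lia.
  pose proof (config_strip true (p + 3) q _ D Hc1 Hq Hn1) as Hc2.
  pose proof (strip_next_corner true (p + 3) q _ D Hc1 Hq) as Hn2; cbn [mirror] in Hn2.
  replace (p + 3 + 3) with (p + 6) in * by lia.
  eexists _, D. split; [exact Hc2|]. split; [auto|]. split; [|exact Hn2].
  rewrite !length_app_strip by lia. lia.
Qed.

Lemma opposite_corners_grid d e p q i j :
  p mod 2 = 1 -> q mod 2 = 1 -> 0 <= i -> 0 <= j ->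
  opposite_corners d e p q -> opposite_corners d e (p + 6 * i) (q + 6 * j).
Proof.
  intros Hp Hq Hi Hj Hb.
  assert (H : forall d e p q n, q mod 2 = 1 ->
    opposite_corners d e p q -> opposite_corners d e (p + 6 * Z.of_nat n) q).
  { clear; intros d e p q n Hq Hb. induction n as [|n IH]; [now replace (p + 6 * Z.of_nat 0) with p by lia|].
    replace (p + 6 * Z.of_nat (S n)) with (p + 6 * Z.of_nat n + 6) by lia.
    now apply opposite_corners_6. }
  replace i with (Z.of_nat (Z.to_nat i)) by lia. replace j with (Z.of_nat (Z.to_nat j)) by lia.
  apply opposite_corners_swap, H; [lia|]. now apply opposite_corners_swap, H.
Qed.

Lemma top_right_corner_grid d e p q i j :
  p mod 2 = 1 -> q mod 2 = 1 -> 0 <= i -> 0 <= j ->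
  top_right_corner d e p q -> top_right_corner d e (p + 6 * i) (q + 6 * j).
Proof.
  intros Hp Hq Hi Hj Hb.
  assert (H : forall d e p q n, q mod 2 = 1 ->
    top_right_corner d e p q -> top_right_corner d e (p + 6 * Z.of_nat n) q).
  { clear; intros d e p q n Hq Hb. induction n as [|n IH]; [now replace (p + 6 * Z.of_nat 0) with p by lia|].
    replace (p + 6 * Z.of_nat (S n)) with (p + 6 * Z.of_nat n + 6) by lia.
    now apply top_right_corner_6. }
  replace i with (Z.of_nat (Z.to_nat i)) by lia. replace j with (Z.of_nat (Z.to_nat j)) by lia.
  apply top_right_corner_swap, H; [lia|]. now apply top_right_corner_swap, H.
Qed.

Lemma opposite_corners_realizable d p q :
  d <= 1 -> opposite_corners d (d + 3) p q -> realizable p q (d + 3).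
Proof.
  intros Hd1 (H & D & Hc & <- & He & H1 & H2).
  apply realizable_three with H; auto; lia.
Qed.

Lemma opposite_corners_realizable_3 d p q :
  d <= 1 -> q mod 2 = 1 -> opposite_corners d (d + 3) p q -> realizable (p + 3) q (d + 3).
Proof.
  intros Hd1 Hq (H & D & Hc & <- & He & H1 & H2).
  pose proof (config_size _ _ _ _ Hc) as [Hp3 Hq3].
  pose proof (config_strip true p q H D Hc Hq H2) as Hc1.
  pose proof (strip_next_corner true p q H D Hc Hq) as Hn1; cbn [mirror] in Hn1.
  apply realizable_three with (H ++ strip true p q); auto; try lia.
  - eapply strip_old_corner; eauto; lia.
  - rewrite length_app_strip by lia. lia.
Qed.

(** The single strip moves the shielded corner from the top right to the bottom right, where the
    deletion takes place. *)
Lemma top_right_corner_realizable_3 p q :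
  q mod 2 = 1 -> top_right_corner 3 5 p q -> realizable (p + 3) q 5.
Proof.
  intros Hq (H & D & Hc & Hd & He & H1).
  pose proof (config_size _ _ _ _ Hc) as [Hp3 Hq3].
  pose proof (config_strip false p q H D Hc Hq H1) as Hc1.
  pose proof (strip_next_corner false p q H D Hc Hq) as Hn1; cbn [mirror] in Hn1.
  replace (q - (q - 1)) with 1 in Hn1 by lia.
  apply realizable_two with (H ++ strip false p q) D; auto; try lia.
  rewrite length_app_strip by lia. lia.
Qed.

Ltac base H D b :=
  exists H, D; split; [apply (config_checked _ _ _ _ b); vm_cast_no_check (eq_refl true)|];
  split; [reflexivity|]; split; [reflexivity|];
  repeat split; apply memPn; vm_compute; reflexivity.

Lemma base_3_3 : opposite_corners 0 3 3 3.
Proof. base [(1, 1); (2, 2)] (@nil cell) 1. Qed.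

Lemma base_3_5 : opposite_corners 0 3 3 5.
Proof. base [(1, 1); (1, 3); (2, 2); (2, 4)] (@nil cell) 1. Qed.

Lemma base_3_7 : opposite_corners 0 3 3 7.
Proof. base [(1, 1); (1, 3); (1, 5); (2, 2); (2, 4); (2, 6)] (@nil cell) 1. Qed.

(** The hole [(1, 1)] shares no vertex with the others, so a loop of tiles runs around it; the rest
    of this loop is the detour once [(0, 0)] is cut. *)
Lemma base_5_5 : opposite_corners 1 4 5 5.
Proof. base [(1, 1); (1, 3); (2, 4); (3, 1); (3, 3); (4, 2); (4, 4)] [(0, 0)] 1. Qed.

Lemma base_7_7 : opposite_corners 1 4 7 7.
Proof.
  base [(1, 1); (1, 3); (1, 5); (2, 4); (2, 6); (3, 1); (3, 3); (4, 2); (4, 4); (4, 6);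
        (5, 1); (5, 5); (6, 2); (6, 4); (6, 6)] [(0, 0)] 1.
Qed.

(** The vertices (1, 1), (2, 1) and (3, 1) touch no hole; each cell of the cut opens one of the two
    by two blocks of tiles around them. *)
Lemma base_7_5 : top_right_corner 3 5 7 5.
Proof.
  base [(1, 2); (1, 4); (2, 3); (3, 2); (3, 4); (4, 1); (5, 2); (5, 4); (6, 1); (6, 3)]
       [(0, 0); (1, 0); (2, 0)] 3.
Qed.

Lemma realizable_odd_square p :
  3 <= p -> p mod 2 = 1 -> realizable p p (if p mod 3 =? 0 then 3 else 4).
Proof.
  intros Hp Hodd.
  assert (p mod 6 = 3 \/ p mod 6 = 5 \/ p mod 6 = 1) as [E|[E|E]] by lia.
  - replace (p mod 3) with 0 by lia. cbn [Z.eqb].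
    replace p with (3 + 6 * (p / 6)) by lia.
    apply (opposite_corners_realizable 0); [lia|].
    apply opposite_corners_grid; try lia. apply base_3_3.
  - replace (p mod 3) with 2 by lia. cbn [Z.eqb].
    replace p with (5 + 6 * (p / 6)) by lia.
    apply (opposite_corners_realizable 1); [lia|].
    apply opposite_corners_grid; try lia. apply base_5_5.
  - replace (p mod 3) with 1 by lia. cbn [Z.eqb].
    replace p with (7 + 6 * (p / 6 - 1)) by lia.
    apply (opposite_corners_realizable 1); [lia|].
    apply opposite_corners_grid; try lia. apply base_7_7.
Qed.

Lemma realizable_power l : realizable (2 ^ Z.of_nat l) (2 ^ Z.of_nat l) 1.
Proof.
  induction l as [|l IH].
  - exists [], [(0, 0)]. cbn [length].
    split; [constructor|]; split; [repeat constructor; intros []|].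
    split; [auto|]; split; [cbn; lia|]; split; [intros c []|]; split; [|split].
    + intros c [<-|[]]; cbn; lia.
    + apply connected_ext with (fun c => In c (tiles 1 1 [(0, 0)])); [intros; apply in_tiles|].
      apply connected_hub with (1, 1). intros c Hc. apply path_sym, reach_path.
      * vm_compute; tauto.
      * vm_compute in Hc |- *. tauto.
    + intros _ c d [<-|[]] [<-|[]]. unfold adj; cbn; lia.
  - rewrite Nat2Z.inj_succ, Z.pow_succ_r by lia.
    pose proof (Z.pow_pos_nonneg 2 (Z.of_nat l)).
    apply realizable_double; auto; lia.
Qed.

Lemma realizable_square n : forall p, 3 <= p -> p <= Z.of_nat n ->
  (forall l : nat, p <> 2 ^ Z.of_nat l) -> realizable p p (if p mod 3 =? 0 then 3 else 4).
Proof.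
  induction n as [|n IH]; intros p Hp Hn Hpow; [lia|].
  assert (p mod 2 = 1 \/ p mod 2 = 0) as [E|E] by lia; [now apply realizable_odd_square|].
  replace p with (2 * (p / 2)) at 1 2 by lia.
  (* The value 4 is a power of two, so an even p is at least 6 and its half at least 3. *)
  assert (p / 2 <> 2).
  { intros E'. apply (Hpow 2%nat). change (2 ^ Z.of_nat 2) with 4. lia. }
  assert (realizable (p / 2) (p / 2) (if (p / 2) mod 3 =? 0 then 3 else 4)) as H1.
  { apply IH; try lia. intros l El. apply (Hpow (S l)).
    rewrite Nat2Z.inj_succ, Z.pow_succ_r by lia. rewrite <- El. lia. }
  replace (p mod 3 =? 0) with ((p / 2) mod 3 =? 0).
  - apply realizable_double; try lia; auto. destruct (_ =? 0); lia.
  - destruct (Z.eqb_spec ((p / 2) mod 3) 0), (Z.eqb_spec (p mod 3) 0); auto; lia.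
Qed.

(** Exactly one side parameter is even; it arises from an odd one by a single last strip along the
    side that stays odd. The residue modulo 6 decides the base box and the side to extend. *)
Lemma realizable_rectangle p :
  5 <= p -> realizable p (p + 1) (if p mod 3 =? 1 then 5 else 3).
Proof.
  intros Hp.
  assert (p mod 6 = 0 \/ p mod 6 = 1 \/ p mod 6 = 2 \/ p mod 6 = 3 \/ p mod 6 = 4 \/ p mod 6 = 5)
    as [E|[E|[E|[E|[E|E]]]]] by lia;
  [replace (p mod 3) with 0 by lia | replace (p mod 3) with 1 by lia
  |replace (p mod 3) with 2 by lia | replace (p mod 3) with 0 by lia
  |replace (p mod 3) with 1 by lia | replace (p mod 3) with 2 by lia]; cbn [Z.eqb].
  - replace (p + 1) with (7 + 6 * (p / 6 - 1)) by lia.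
    replace p with (3 + 6 * (p / 6 - 1) + 3) at 1 by lia.
    apply (opposite_corners_realizable_3 0); try lia.
    apply opposite_corners_grid; try lia. apply base_3_7.
  - apply realizable_swap.
    replace (p + 1) with (5 + 6 * (p / 6 - 1) + 3) by lia.
    replace p with (7 + 6 * (p / 6 - 1)) at 2 by lia.
    apply top_right_corner_realizable_3; try lia.
    apply top_right_corner_swap, top_right_corner_grid; try lia. apply base_7_5.
  - replace (p + 1) with (3 + 6 * (p / 6)) by lia.
    replace p with (5 + 6 * (p / 6 - 1) + 3) at 1 by lia.
    apply (opposite_corners_realizable_3 0); try lia.
    apply opposite_corners_grid; try lia. apply opposite_corners_swap, base_3_5.
  - apply realizable_swap.
    replace (p + 1) with (7 + 6 * (p / 6 - 1) + 3) by lia.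
    replace p with (3 + 6 * (p / 6)) at 2 by lia.
    apply (opposite_corners_realizable_3 0); try lia.
    apply opposite_corners_swap, opposite_corners_grid; try lia. apply base_3_7.
  - replace (p + 1) with (5 + 6 * (p / 6)) by lia.
    replace p with (7 + 6 * (p / 6 - 1) + 3) at 1 by lia.
    apply top_right_corner_realizable_3; try lia.
    apply top_right_corner_grid; try lia. apply base_7_5.
  - apply realizable_swap.
    replace (p + 1) with (3 + 6 * (p / 6) + 3) by lia.
    replace p with (5 + 6 * (p / 6)) at 2 by lia.
    apply (opposite_corners_realizable_3 0); try lia.
    apply opposite_corners_grid; try lia. apply base_3_5.
Qed.

(** * Extremal values *)

Lemma realizable_polyomino p q C :
  1 <= p -> 1 <= q -> realizable p q C ->
  exists A h, is_polyomino A /\ num_holes A h /\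
    (forall c, In c A -> 0 <= fst c <= p /\ 0 <= snd c <= q) /\
    3 * Z.of_nat h + C = p * q /\
    Z.of_nat (length A) = (p + 1) * (q + 1) - Z.of_nat h - C.
Proof.
  intros Hp Hq (H & K & HN & HN' & HC & Hn & Hiso & HK & Hcon & _).
  assert (HKH : forall c, In c K -> ~ In c H).
  { intros c Hc HcH. apply Hiso in HcH as (? & ? & _). apply HK in Hc. lia. }
  assert (Hlen : Z.of_nat (length (tiles p q (H ++ K))) = (p + 1) * (q + 1) - Z.of_nat (length H) - C).
  { pose proof (length_tiles p q (H ++ K)) as Hl. rewrite length_app in Hl.
    enough (Z.of_nat (length (tiles p q (H ++ K))) + Z.of_nat (length H + length K) =
      (p + 1) * (q + 1)) by lia.
    apply Hl; try lia.
    - apply NoDup_app; auto. intros c Hc Hk. now apply (HKH c).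
    - intros c Hc; apply in_app_iff in Hc as [Hc|Hc]; [apply Hiso in Hc; lia|apply HK in Hc; lia]. }
  exists (tiles p q (H ++ K)), (length H).
  split; [|split; [|split; [|split; [auto|auto]]]].
  - split; [apply NoDup_tiles|split].
    + intros E. rewrite E in Hlen; cbn [length] in Hlen. nia.
    + intros a b Ha Hb. apply path_mono with (board p q (H ++ K)); [intros c; apply in_tiles|].
      apply Hcon; now apply in_tiles.
  - apply num_holes_tiles; auto. intros c Hc; split; auto. apply HK in Hc; lia.
  - intros c Hc; apply in_tiles in Hc as (? & ? & _); lia.
Qed.

Lemma holes_in_box p q A h :
  5 <= p -> q = p \/ q = p + 1 ->
  is_polyomino A -> num_holes A h ->
  (forall c, In c A -> 0 <= fst c <= p /\ 0 <= snd c <= q) ->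
  3 * Z.of_nat h + 3 <= p * q \/
  3 * Z.of_nat h + 1 = p * q /\ exists l : nat, p = 2 ^ Z.of_nat l /\ q = 2 ^ Z.of_nat l.
Proof.
  intros Hp Hq HA Hh Hbox.
  destruct (fill_box p q A h HA Hh Hbox) as (H & HN & <- & Hiso & Hcon).
  pose proof (cyclomatic_pos p q H ltac:(lia) ltac:(lia) HN Hiso Hcon) as Hc.
  assert (p * q = 3 * Z.of_nat (length H) + 1 \/ p * q = 3 * Z.of_nat (length H) + 2 \/
    3 * Z.of_nat (length H) + 3 <= p * q) as [E|[E|E]] by lia; [right|exfalso|left; auto].
  - split; [lia|]. apply (perfect_power (Z.to_nat p) p q H); auto; lia.
  - destruct Hq as [-> | ->].
    (* A square is never 2 modulo 3. *)
    + assert (p mod 3 = 0 \/ p mod 3 = 1 \/ p mod 3 = 2) as Hm by lia.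
      set (k := p / 3). assert (p = 3 * k + p mod 3) as Ek by (unfold k; lia).
      destruct Hm as [Hm|[Hm|Hm]]; rewrite Hm in Ek; clearbody k; subst p; clear - E; nia.
    + pose proof (cyclomatic_odd p (p + 1) H ltac:(lia) ltac:(lia) ltac:(lia) HN Hiso Hcon). lia.
Qed.

(** With u and v the sides of the bounding box minus one, a smaller polyomino would have u + v < p +
    q but u*v >= p*q - C. Then 4*u*v <= (u + v)^2 forces C >= p for q = p and for q = p + 1. *)
Lemma tiles_lower_bound p q C A h :
  C < p -> 0 <= C -> q = p \/ q = p + 1 -> 3 * Z.of_nat h + C = p * q ->
  is_polyomino A -> num_holes A h ->
  (p + 1) * (q + 1) - Z.of_nat h - C <= Z.of_nat (length A).
Proof.
  intros HC HC0 Hq Hh HA Hn.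
  destruct (bounding_box A h HA Hn) as (_ & _ & a & b & Ha & Hb & _ & Hab & Hex & Hey).
  destruct HA as (HA1 & HA2 & HA3).
  (* With no circulations this is the tree bound: a connected graph has at least one edge fewer than
     vertices. *)
  pose proof (circulations_bound 0 0 A [] ltac:(lia) ltac:(lia) HA1 HA2 HA3) as Hedge.
  cbn [map length] in Hedge.
  assert (length A + 0 <= length (links dirx A) + length (links diry A) + 1)%nat as He
    by (apply Hedge; [intros ? [] | exact I]).
  destruct (Z_le_gt_dec ((p + 1) * (q + 1) - Z.of_nat h - C) (Z.of_nat (length A))) as [|Hlt]; auto.
  exfalso.
  set (u := Z.of_nat a - 1). set (v := Z.of_nat b - 1).
  assert (Hs : u + v <= p + q - 1) by lia.
  assert (Huv : p * q - C <= u * v).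
  { assert (Z.of_nat (length A) + Z.of_nat h <= (u + 1) * (v + 1)).
    { unfold u, v. replace (Z.of_nat a - 1 + 1) with (Z.of_nat a) by lia.
      replace (Z.of_nat b - 1 + 1) with (Z.of_nat b) by lia. lia. }
    lia. }
  assert (0 <= u /\ 0 <= v) as [Hu Hv] by lia.
  assert (4 * (u * v) <= (u + v) * (u + v)) by (pose proof (Z.square_nonneg (u - v)); lia).
  assert ((u + v) * (u + v) <= (p + q - 1) * (p + q - 1)) by (apply Z.mul_le_mono_nonneg; lia).
  clearbody u v. clear - HC HC0 Hq Huv H H0. destruct Hq as [-> | ->]; lia.
Qed.

(** Makes the first two cases of [C_spec] exclusive: N = 2^l + 1 is never 1 modulo 3. *)
Lemma pow2_mod_3 l : 2 ^ Z.of_nat l mod 3 <> 0.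
Proof.
  induction l as [|l IH]; [cbn; lia|].
  rewrite Nat2Z.inj_succ, Z.pow_succ_r by lia. lia.
Qed.

Lemma pow2_plus1_iff N : (6 <= N)%nat ->
  (pow2_plus1 N <-> exists l : nat, Z.of_nat N - 1 = 2 ^ Z.of_nat l).
Proof.
  intros HN; split.
  - intros (l & _ & ->); exists l.
    rewrite Nat2Z.inj_add, Nat2Z.inj_pow. change (Z.of_nat 2) with 2. lia.
  - intros (l & El); exists l. split; [destruct l; [cbn in El; lia | lia]|].
    apply Nat2Z.inj. rewrite Nat2Z.inj_add, Nat2Z.inj_pow. change (Z.of_nat 2) with 2. lia.
Qed.

(** The bound C < N - 1 serves the minimal tile count; C <= 5 and the clauses on powers of two serve
    the maximal hole count. *)
Lemma C_value N M :
  (6 <= N)%nat -> (M = N \/ M = S N) ->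
  exists C, 0 <= C < Z.of_nat N - 1 /\ C <= 5 /\
    realizable (Z.of_nat N - 1) (Z.of_nat M - 1) C /\
    (C < 3 -> pow2_plus1 N) /\ (pow2_plus1 N -> M = N -> C < 3) /\
    forall C', C_spec N M C' -> C' = C.
Proof.
  intros HN HM. set (p := Z.of_nat N - 1).
  assert (HNp : Z.of_nat N = p + 1) by lia.
  assert (Hmod : Z.of_nat (N mod 3) = (p + 1) mod 3) by (rewrite Nat2Z.inj_mod, HNp; auto).
  destruct HM as [-> | ->].
  - fold p. destruct (classic (pow2_plus1 N)) as [Hpow|Hpow].
    + exists 1. split; [lia|]; split; [lia|]. split; [|split; [auto|split; [lia|]]].
      * apply pow2_plus1_iff in Hpow as (l & El); auto. fold p in El. rewrite El.
        apply realizable_power.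
      * intros C' HC'; inversion HC'; subst; auto; try lia; try contradiction.
        exfalso. apply pow2_plus1_iff in Hpow as (l & El); auto. apply (pow2_mod_3 l). lia.
    + exists (if p mod 3 =? 0 then 3 else 4).
      split; [destruct (_ =? _); lia|]; split; [destruct (_ =? _); lia|].
      split; [|split; [destruct (_ =? _); lia|split; [intros; contradiction|]]].
      * apply (realizable_square (Z.to_nat p)); try lia. intros l El. apply Hpow.
        apply pow2_plus1_iff; auto. now exists l.
      * intros C' HC'; inversion HC'; subst; auto; try lia; try contradiction;
          destruct (Z.eqb_spec (p mod 3) 0); lia.
  - exists (if p mod 3 =? 1 then 5 else 3).
    split; [destruct (Z.eqb_spec (p mod 3) 1); lia|]; split; [destruct (_ =? _); lia|].
    split; [|split; [destruct (_ =? _); lia|split; [lia|]]].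
    + replace (Z.of_nat (S N) - 1) with (p + 1) by lia. apply realizable_rectangle; lia.
    + intros C' HC'; inversion HC'; subst; auto; try lia;
        destruct (Z.eqb_spec (p mod 3) 1); lia.
Qed.

Theorem theorem2 (N M : nat) :
  (6 <= N)%nat -> (M = N \/ M = S N) ->
  exists H : nat, is_max_holes N M H /\
    forall C : Z, C_spec N M C ->
      g_value H (Z.of_nat (N * M) - Z.of_nat H - C).
Proof.
  intros HN HM.
  destruct (C_value N M HN HM) as (C & HC & HC5 & Hreal & Hpow & Hpow' & Huniq).
  set (p := Z.of_nat N - 1) in *. set (q := Z.of_nat M - 1) in *.
  destruct (realizable_polyomino p q C ltac:(lia) ltac:(lia) Hreal) as (A & H & HA & HH & Hbox & HnH & Hlen).
  exists H; split; [split|].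
  - exists A; split; [auto|]; split; auto.
    intros c Hc; apply Hbox in Hc; lia.
  - intros B h HB Hbb Hh.
    (* Here p*q = 3H + C. If 3h + 3 <= p*q, then C <= 5 gives h <= H; if 3h + 1 = p*q, the box is a
       square with a power of two as side parameter, and C < 3 gives h <= H. *)
    destruct (holes_in_box p q B h) as [Hle|[Heq (l & El & El')]]; auto; try lia.
    + intros c Hc; apply Hbb in Hc; lia.
    + assert (pow2_plus1 N) by (apply pow2_plus1_iff; auto; now exists l).
      assert (M = N) by lia. specialize (Hpow' H0 H1). lia.
  - intros C' HC'. rewrite (Huniq C' HC').
    replace (Z.of_nat (N * M) - Z.of_nat H - C) with ((p + 1) * (q + 1) - Z.of_nat H - C)
      by (unfold p, q; lia).
    split.
    + exists A; auto.
    + intros B HB HhB. apply (tiles_lower_bound p q); auto; lia.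
Qed.
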